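(* Let $\aleph$ be an infinite cardinal, $\mathbb K$ a field, and $I$ an $\aleph$-poset having a finite cofinal subset. If $J$ is any subset of $I$, then the $\mathbb K$-algebra $H(I,J)$ is locally unit-regular. Consequently $H(I,J)$ is unit-regular in case $J$ is finitely sheltered in $I$; in particular $\mathfrak B(I)$ is unit-regular.
   Context: A unital ring $R$ is unit-regular if for every $x\in R$ there is a unit $y\in R$ with $x=xyx$. A not necessarily unital ring $R$ is locally unit-regular if for every idempotent $e\in R$ the unital ring $eRe$ is unit-regular. For $J\subseteq I$ let $J^{\bigstar}$ be the set of those maximal elements $m$ of $I$ such that $j\le m$ for some $j\in J$. The subset $J$ is finitely sheltered in $I$ if $J^{\bigstar}$ is finite, every element of $J$ is $\le$ some element of $J^{\bigstar}$, and $J^{\bigstar}\subseteq J$ (in this case, when $I$ has a finite cofinal subset, the ring $H(I,J)$ defined below has a multiplicative identity). Conventions. $\aleph$ is an infinite cardinal, regarded as an initial ordinal, so that $\emptyset\in\aleph$; $\mathbb K$ is a field. For a poset $P$, $\mathcal M(P)$ is the set of all maximal chains of $P$ (maximal totally ordered subsets). An $\aleph$-poset is a partially ordered set $I$ with $|I|\le\aleph$ and $|\mathcal M(I)|\le\aleph$. For $i\in I$: $\{i\le\}=\{k\in I: i\le k\}$, $\{\le i\}=\{k\in I:k\le i\}$, $\{i\not\le\}=I\setminus\{i\le\}$, with the induced orders. For a set $A$, $\aleph^{(A)}$ is the set of maps $p:A\to\aleph$ with $p(a)=\emptyset$ for all but finitely many $a\in A$. For a set $X$, $\mathrm{CFM}_X(\mathbb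 K)$ is the $\mathbb K$-algebra of column-finite $X\times X$ matrices over $\mathbb K$, and $\mathrm{FR}_X(\mathbb K)$ is its ideal of matrices with only finitely many nonzero rows; $a(x,y)$ denotes the entry of $a$ in row $x$, column $y$. Construction. Let $X(I)=\aleph^{(I)}\times\mathcal M(I)$ and $Q(I)=\mathrm{CFM}_{X(I)}(\mathbb K)$. For $i\in I$ let $X(i\le)=\aleph^{(\{i\le\})}\times\mathcal M(\{i\le\})$ and let $\psi_{I,i}:\mathrm{CFM}_{X(i\le)}(\mathbb K)\to Q(I)$ be the injective (not necessarily unital) $\mathbb K$-algebra homomorphism given, for $p,q\in\aleph^{(I)}$ and $A,B\in\mathcal M(I)$, by $$\psi_{I,i}(a)((p,A),(q,B))=a\big((p|_{\{i\le\}},A\cap\{i\le\}),(q|_{\{i\le\}},B\cap\{i\le\})\big)$$ if $i\in A\cap B$, $A\cap\{\le i\}=B\cap\{\le i\}$ and $p|_{\{i\not\le\}}=q|_{\{i\not\le\}}$, and $\psi_{I,i}(a)((p,A),(q,B))=0$ otherwise. Put $H(I,i)=\psi_{I,i}(\mathrm{FR}_{X(i\le)}(\mathbb K))$ if $i$ is not a maximal element of $I$, and $H(I,i)=\mathbb K\,\psi_{I,i}(\mathbf 1)$ if $i$ is a maximal element of $I$. For $J\subseteq I$ put $H(I,J)=\sum_{j\in J}H(I,j)\subseteq Q(I)$; this sum is direct and $H(I,J)$ is a (not necessarily unital) $\mathbb K$-subalgebra of $Q(I)$. Finally $\mathfrak B(I)=H(I,I)$, which is a unital subalgebra of $Q(I)$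 when $I$ has a finite cofinal subset. *)

(* Defs.v *)
From HB Require Import structures.
From mathcomp Require Import all_boot all_order all_algebra.
From mathcomp Require Import finmap mathcomp_extra boolp classical_sets functions.
From mathcomp Require Import cardinality fsbigop.

Set Implicit Arguments.
Unset Strict Implicit.
Unset Printing Implicit Defensive.

Import Order.TTheory GRing.Theory.
Local Open Scope classical_set_scope.
Local Open Scope ring_scope.
Local Open Scope card_scope.

(** * Regularity of subrings

   The predicates below concern a not necessarily unital subring [S] of a ring
   [R].  The identity element of [S], when there is one, need not be [1 : R],
   and units are units of [S]. *)

Section UnitRegular.
Context {R : pzRingType}.
Implicit Type S : set R.

Definition is_identity S (u : R) :=
  S u /\ forall x, S x -> u * x = x /\ x * u = x.

Definition is_unit_of S (u y : R) :=
  S y /\ exists2 z, S z & y * z = u /\ z * y = u.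

Definition unit_regular S :=
  exists2 u, is_identity S u &
    forall x, S x -> exists2 y, is_unit_of S u y & x = x * y * x.

Definition corner S (e : R) : set R := [set e * x * e | x in S].

Definition locally_unit_regular S :=
  forall e, S e -> e * e = e -> unit_regular (corner S e).

End UnitRegular.

(** * Column-finite matrices *)

Section CFM.
Variables (K : fieldType) (X : choiceType).

Definition column_finite (a : X -> X -> K) :=
  forall y, finite_set [set x | a x y != 0].

Definition cfm_pred : {pred X -> X -> K} := [pred a | `[< column_finite a >]].

Record CFM := MkCFM { cfm_val :> X -> X -> K; _ : cfm_val \in cfm_pred }.

HB.instance Definition _ := [isSub for cfm_val].
HB.instance Definition _ := [Choice of CFM by <:].

Lemma cfmP (a : CFM) : column_finite a.
Proof. by case: a => a /= /asboolP. Qed.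

Definition cfm (a : X -> X -> K) (ha : column_finite a) : CFM :=
  MkCFM (asboolT ha : a \in cfm_pred).

Lemma cfm_ext (a b : CFM) : (forall x y, a x y = b x y) -> a = b.
Proof. by move=> ab; apply/val_inj/funext => x; apply/funext => y; exact: ab. Qed.

Lemma cfm_zmod_closed : zmod_closed cfm_pred.
Proof.
split; first by apply/asboolP => y; rewrite (_ : mkset _ = set0)// -subset0 => x /=; rewrite eqxx.
move=> a b /asboolP fa /asboolP fb; apply/asboolP => y.
apply: (@sub_finite_set _ _ ([set x | a x y != 0] `|` [set x | b x y != 0])).
  move=> x /=; have [ax|ax] := eqVneq (a x y) 0; last by left.
  by have -> : (a - b) x y = a x y - b x y by []; rewrite ax sub0r oppr_eq0; right.
by rewrite finite_setU.
Qed.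

HB.instance Definition _ :=
  GRing.isZmodClosed.Build (X -> X -> K) cfm_pred cfm_zmod_closed.

HB.instance Definition _ := [SubChoice_isSubZmodule of CFM by <:].

Let scale_cf k (a : CFM) : column_finite (fun x y => k * a x y).
Proof.
move=> y; apply: sub_finite_set (cfmP a y) => x /=.
by apply: contra_neq => ->; rewrite mulr0.
Qed.

Definition cfm_scale k (a : CFM) : CFM := cfm (@scale_cf k a).

Let cfm_scaleA k l a : cfm_scale k (cfm_scale l a) = cfm_scale (k * l) a.
Proof. by apply: cfm_ext => x y /=; rewrite mulrA. Qed.

Let cfm_scale1 : left_id 1 cfm_scale.
Proof. by move=> a; apply: cfm_ext => x y /=; rewrite mul1r. Qed.

Let cfm_scaleDr : right_distributive cfm_scale +%R.
Proof. by move=> k a b; apply: cfm_ext => x y; exact: mulrDr. Qed.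

Let cfm_scaleDl a : {morph cfm_scale^~ a : k l / k + l}.
Proof. by move=> k l; apply: cfm_ext => x y; exact: mulrDl. Qed.

HB.instance Definition _ := GRing.Zmodule_isLmodule.Build K CFM
  cfm_scaleA cfm_scale1 cfm_scaleDr cfm_scaleDl.

Implicit Types a b c : CFM.

Let mulf (a b : CFM) x y : K := \sum_(z \in [set: X]) a x z * b z y.

Let supp (b : CFM) y : {fset X} := fset_set [set z | b z y != 0].

Let suppP b y z : z \notin supp b y -> b z y = 0.
Proof.
apply: contraNeq => bzy; rewrite in_fset_set ?inE//; exact: cfmP.
Qed.

Let mulfE a b x y (F : {fset X}) : (forall z, z \notin F -> b z y = 0) ->
  mulf a b x y = \sum_(z <- F) a x z * b z y.
Proof. by move=> F0; rewrite /mulf (fsbigTE F)// => z /F0 ->; rewrite mulr0. Qed.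

Let mulf_cf a b : column_finite (mulf a b).
Proof.
move=> y; apply: (@sub_finite_set _ _
  (\bigcup_(z in [set` supp b y]) [set x | a x z != 0])).
  move=> x /=; rewrite (mulfE _ _ (@suppP b y)); apply: contra_neqP => ax0.
  apply: big1_seq => z /andP[_ zb]; case: (eqVneq (a x z) 0) => [->|azx].
    by rewrite mul0r.
  by exfalso; apply: ax0; exists z.
by apply: bigcup_finite => [|z _]; [exact: finite_fset|exact: cfmP].
Qed.

Definition cfm_mul a b : CFM := cfm (mulf_cf a b).

Let idf (x y : X) : K := (x == y)%:R.

Let idf_cf : column_finite idf.
Proof.
move=> y; apply: (@sub_finite_set _ _ [set y]) => [x /=|]; last exact: finite_set1.
by rewrite /idf; case: (eqVneq x y) => //; rewrite eqxx.
Qed.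

Definition cfm_one : CFM := cfm idf_cf.

Let cfm_mulA : associative cfm_mul.
Proof.
move=> a b c; apply: cfm_ext => x y /=.
have bc0 z : z \notin (\bigcup_(w <- supp c y) supp b w)%fset ->
    cfm_mul b c z y = 0.
  move=> zN; rewrite /= (mulfE _ _ (@suppP c y)) big1_seq// => w /andP[_ wc].
  rewrite (@suppP b w z) ?mul0r//; apply: contra zN => zb.
  by apply/bigfcupP; exists w; rewrite ?wc.
rewrite (mulfE _ _ bc0) (mulfE _ _ (@suppP c y)).
transitivity (\sum_(z <- (\bigcup_(w <- supp c y) supp b w)%fset)
    \sum_(w <- supp c y) a x z * b z w * c w y).
  apply: eq_bigr => z _; rewrite /= (mulfE _ _ (@suppP c y)) mulr_sumr.
  by apply: eq_bigr => w _; rewrite mulrA.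
rewrite exchange_big; apply: eq_big_seq => w wc /=.
rewrite (@mulfE _ _ _ _ (\bigcup_(w <- supp c y) supp b w)%fset) ?mulr_suml//.
move=> z zN; apply: (@suppP b w z); apply: contra zN => zb.
by apply/bigfcupP; exists w; rewrite ?wc.
Qed.

Let cfm_mul1 : left_id cfm_one cfm_mul.
Proof.
move=> a; apply: cfm_ext => x y /=; rewrite /mulf.
rewrite (fsbigTE [fset x]%fset) => [|z]; last first.
  by rewrite inE /= /idf eq_sym => /negbTE ->; rewrite mul0r.
by rewrite big_seq_fset1 /= /idf eqxx mul1r.
Qed.

Let cfm_1mul : right_id cfm_one cfm_mul.
Proof.
move=> a; apply: cfm_ext => x y /=.
rewrite (@mulfE _ _ _ _ [fset y]%fset) => [|z].
  by rewrite big_seq_fset1 /= /idf eqxx mulr1.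
by rewrite inE /= /idf => /negbTE ->.
Qed.

Let cfm_mulDl : left_distributive cfm_mul +%R.
Proof.
move=> a b c; apply: cfm_ext => x y.
have -> : (cfm_mul a c + cfm_mul b c) x y = mulf a c x y + mulf b c x y by [].
rewrite /= !(mulfE _ _ (@suppP c y)) -big_split /=.
by apply: eq_bigr => z _; rewrite -mulrDl.
Qed.

Let cfm_mulDr : right_distributive cfm_mul +%R.
Proof.
move=> a b c; apply: cfm_ext => x y.
have -> : (cfm_mul a b + cfm_mul a c) x y = mulf a b x y + mulf a c x y by [].
rewrite /= !(@mulfE _ _ x y (supp b y `|` supp c y)%fset).
- by rewrite -big_split /=; apply: eq_bigr => z _; rewrite -mulrDr.
- by move=> z; rewrite inE negb_or => /andP[_ /suppP].
- by move=> z; rewrite inE negb_or => /andP[/suppP].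
- move=> z; rewrite inE negb_or => /andP[/suppP bz /suppP cz].
  by have -> : (b + c) z y = b z y + c z y by []; rewrite bz cz addr0.
Qed.

HB.instance Definition _ := GRing.Zmodule_isPzRing.Build CFM
  cfm_mulA cfm_mul1 cfm_1mul cfm_mulDl cfm_mulDr.

Lemma cfm_mulE a b x y : (a * b) x y = \sum_(z \in [set: X]) a x z * b z y.
Proof. by []. Qed.

Lemma cfm_oneE x y : (1 : CFM) x y = (x == y)%:R.
Proof. by []. Qed.

Definition FR : set CFM :=
  [set a | finite_set [set x | exists y, a x y != 0]].

End CFM.
Arguments FR : clear implicits.

(* Every [porderType] is a [choiceType]; classically this is no restriction. *)

(** * Posets *)

Section Posets.
Context {d : Order.disp_t} {P : porderType d}.
Implicit Types (A B : set P).

Definition maximal_chains : set (set P) :=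
  [set A | total_on A <=%O /\ forall B, total_on B <=%O -> A `<=` B -> B = A].

Definition is_maximal (m : P) := forall k, (m <= k)%O -> k = m.

Definition finite_cofinal :=
  exists2 F : set P, finite_set F & forall i, exists2 f, F f & (i <= f)%O.

Definition star A : set P :=
  [set m | is_maximal m /\ exists2 j, A j & (j <= m)%O].

Definition finitely_sheltered A :=
  [/\ finite_set (star A),
      forall j, A j -> exists2 m, star A m & (j <= m)%O &
      star A `<=` A].

End Posets.
Arguments maximal_chains {d} P.
Arguments finite_cofinal {d} P.

Section Up.
Context {d : Order.disp_t} {P : porderType d}.

Definition upset (i : P) := {k : P | (i <= k)%O}.

HB.instance Definition _ i := SubChoice.on (upset i).
HB.instance Definition _ i := [SubChoice_isSubPOrder of upset i by <: with d].

Definition trace i (A : set P) : set (upset i) := [set k | A (val k)].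
Arguments trace : clear implicits.

Lemma maximal_chain_trace i A :
  maximal_chains P A -> A i -> maximal_chains (upset i) (trace i A).
Proof.
move=> [Achain Amax] Ai; split=> [k l Ak Al|C Cchain AC].
  exact: (Achain _ _ Ak Al).
pose B : set P := [set k | A k /\ (k <= i)%O] `|` [set val k | k in C].
have Bchain : total_on B <=%O.
  move=> k l [[Ak ki]|[k' Ck' <-]] [[Al li]|[l' Cl' <-]].
  - exact: Achain.
  - by left; rewrite (le_trans ki) ?(valP l').
  - by right; rewrite (le_trans li) ?(valP k').
  - exact: (Cchain k' l').
have AB : A `<=` B.
  move=> k Ak; have [ik|ki] := Achain _ _ Ai Ak; last by left.
  by right; exists (exist _ k ik : upset i) => //; exact: AC.
apply/seteqP; split=> // k Ck; rewrite /trace/= -(Amax _ Bchain AB).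
by right; exists k.
Qed.

End Up.
Arguments trace {d P} i A.

Section InfiniteCardinal.
Context {d : Order.disp_t}.

(* The cardinal [aleph] is the initial ordinal [aleph], an order type; the
   ordinal 0, i.e., the empty set, is [\bot]. *)
Definition infinite_initial_ordinal (aleph : bOrderType d) :=
  [/\ well_founded (fun x y : aleph => (x < y)%O),
      forall a : aleph, ~ ([set: aleph] #<= [set x : aleph | (x < a)%O]) &
      infinite_set [set: aleph]].

Definition aleph_poset (aleph : bOrderType d) d' (I : porderType d') :=
  [set: I] #<= [set: aleph] /\ maximal_chains I #<= [set: aleph].

End InfiniteCardinal.

(** * The algebras H(I,J) *)

Section Construction.
Context {d : Order.disp_t} (aleph : bOrderType d) (K : fieldType).

Section IndexSet.
Context {d' : Order.disp_t} (P : porderType d').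

Definition finsupp_maps : set (P -> aleph) :=
  [set p | finite_set [set a | p a != \bot%O]].

Definition Xindex : choiceType := (finsupp_maps * maximal_chains P)%type.

End IndexSet.
Arguments finsupp_maps {d'} P.
Arguments Xindex {d'} P.

Context {d' : Order.disp_t} {I : porderType d'}.
Implicit Types (i j : I) (J : set I).

Lemma finsupp_restr i (p : finsupp_maps I) :
  (fun k : upset i => val p (val k)) \in finsupp_maps (upset i).
Proof.
case: p => p /= /set_mem pfin; apply/mem_set.
by apply: finite_preimage pfin => k l _ _; exact: val_inj.
Qed.

(* [(p, A) |-> (p|_{i <=}, A `&` {i <=})] *)
Definition restr i (x : Xindex I) (xi : val x.2 i) : Xindex (upset i) :=
  (SigSub (finsupp_restr i x.1) : finsupp_maps (upset i),
   SigSub (mem_set (maximal_chain_trace (set_mem (valP x.2)) xi)) : maximal_chains (upset i)).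

(* For chains [A], [B] containing [i]: [A] and [B] agree below [i], and [p] and
   [q] agree off [{i <=}]. *)
Definition linked i (x y : Xindex I) :=
  val x.2 `&` [set k | (k <= i)%O] = val y.2 `&` [set k | (k <= i)%O] /\
  (forall k, ~~ (i <= k)%O -> val x.1 k = val y.1 k).

Definition psi_fun i (a : CFM K (Xindex (upset i))) (x y : Xindex I) : K :=
  match pselect (val x.2 i), pselect (val y.2 i), pselect (linked i x y) with
  | left xi, left yi, left _ => a (restr xi) (restr yi)
  | _, _, _ => 0
  end.

Lemma restr_linked_inj i (x y : Xindex I) (xi : val x.2 i) (yi : val y.2 i) :
  restr xi = restr yi -> linked i x y -> x = y.
Proof.
case: x y xi yi => [p A] [q B] /= Ai Bi [] epq eAB [/= eA epq'].
congr pair; apply: val_inj.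
  apply/funext => k; have [ik|/epq'//] := boolP (i <= k)%O.
  exact: (congr1 (fun f => f (exist _ k ik : upset i)) epq).
have sub (C D : maximal_chains I) : val C i ->
    trace i (val C) = trace i (val D) ->
    val C `&` [set k | (k <= i)%O] = val D `&` [set k | (k <= i)%O] ->
    val C `<=` val D.
  move=> Ci eCD eCD' k Ck.
  have [/(_ _ _ Ci Ck)[ik|ki] _] := set_mem (valP C).
    by have := congr1 (fun f => f (exist _ k ik : upset i)) eCD; rewrite /trace /= => <-.
  suff [] : (val D `&` [set k | (k <= i)%O]) k by [].
  by rewrite -eCD'.
by apply/seteqP; split; apply: sub.
Qed.

Lemma psi_cf i (a : CFM K (Xindex (upset i))) : column_finite (psi_fun a).
Proof.
move=> y; have [yi|yNi] := pselect (val y.2 i); last first.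
  rewrite (_ : mkset _ = set0)// -subset0 => x /=; rewrite /psi_fun.
  by case: pselect => [xi|]; rewrite ?eqxx//; case: pselect => //; rewrite eqxx.
pose g x := if pselect (val x.2 i) is left xi then restr xi else restr yi.
pose S := [set x | val x.2 i /\ linked i x y] `&` g @^-1` [set z | a z (restr yi) != 0].
apply: (@sub_finite_set _ _ S) => [x /=|].
  rewrite /psi_fun /S /g /=; case: pselect => [xi|]; last by rewrite eqxx.
  case: pselect => [yi'|//]; rewrite (Prop_irrelevance yi' yi).
  by case: pselect => [xy|]; rewrite ?eqxx.
have Sinj : {in S &, injective g}.
  move=> u v /set_mem[[ui uy] _] /set_mem[[vi vy] _]; rewrite /g.
  case: pselect => // ui'; case: pselect => // vi' euv; apply: (restr_linked_inj euv).
  by split=> [|k ik]; [rewrite uy.1 vy.1|rewrite uy.2// vy.2].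
rewrite -(eq_finite_set (inj_card_eq Sinj)).
by apply: sub_finite_set (cfmP a (restr yi)) => z [u [_ ?] <-].
Qed.

Definition psi i (a : CFM K (Xindex (upset i))) : CFM K (Xindex I) :=
  cfm (psi_cf a).

Definition H_elt i : set (CFM K (Xindex I)) :=
  if pselect (is_maximal i) then
    [set k *: psi (1 : CFM K (Xindex (upset i))) | k in [set: K]]
  else [set psi a | a in FR K (Xindex (upset i))].

Definition H_alg J : set (CFM K (Xindex I)) :=
  [set x | exists (s : seq I) (h : I -> CFM K (Xindex I)),
     (forall j, j \in s -> J j /\ H_elt j (h j)) /\ x = \sum_(j <- s) h j].

Definition B_alg : set (CFM K (Xindex I)) := H_alg [set: I].

End Construction.
Arguments H_alg {d} aleph K {d' I} J.
Arguments B_alg {d} aleph K {d'} I.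

(* Main.v *)
Require Import Defs.
From mathcomp Require Import all_boot all_order all_algebra.
From mathcomp Require Import finmap mathcomp_extra boolp classical_sets functions.
From mathcomp Require Import cardinality fsbigop.

(* An element of H(I,J) involves only finitely many indices, so J may be taken
   finite; let i be minimal in J.  Then H(I,i) is an ideal of the unitization
   K + H(I,J), with complement K + H(I,J \ {i}), and each of its elements is a
   finite sum of elements e w, where e is an idempotent with division corner (a
   diagonal matrix unit, or the identity of H(I,i) when i is maximal).  Adding
   such a rank-one element to a unit-regular element t keeps it unit-regular:
   after multiplication by a unit t is an idempotent g, and elementary
   operations reduce to the blocks of g.  By induction on J the unitization is
   unit-regular, and this passes to the corner at an idempotent e through the
   elements a + (1 - e) (Lam and Murray).

   If J is finitely sheltered, the sum of the psi_m(1), m in J^star, is an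
   identity of H(I,J): since I has a finite cofinal subset, every maximal chain
   contains exactly one maximal element of I. *)

Set Implicit Arguments.
Unset Strict Implicit.
Unset Printing Implicit Defensive.

Import Order.TTheory GRing.Theory.
Local Open Scope classical_set_scope.
Local Open Scope ring_scope.

(** * Unit-regular elements of a subring *)

Section UnitalSubring.
Context {R : pzRingType}.
Implicit Types (S : set R) (e g u v w x y z : R).

Definition unital_subring S :=
  [/\ S 1, forall x y, S x -> S y -> S (x - y) &
      forall x y, S x -> S y -> S (x * y)].

Definition unit_regular_in S x := exists2 y, is_unit_of S 1 y & x = x * y * x.

(** Encodes an idempotent of rank one: [Se] and [eS] are minimal one-sided ideals (or [e = 0]),
    since every nonzero [v] in them can be multiplied back to [e]. *)
Definition primitive S e :=
  [/\ S e, e * e = e,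
      forall v, S v -> v * e = v -> v != 0 ->
        exists2 w, S w & e * w = w /\ w * v = e &
      forall v, S v -> e * v = v -> v != 0 ->
        exists2 w, S w & w * e = w /\ v * w = e].

Context (S : set R) (Ssub : unital_subring S).

Let S1 : S 1. Proof. by case: Ssub. Qed.
Let SB x y : S x -> S y -> S (x - y). Proof. by case: Ssub => _ + _; exact. Qed.
Let SM x y : S x -> S y -> S (x * y). Proof. by case: Ssub => _ _; exact. Qed.
Let S0 : S 0. Proof. by rewrite -(subrr 1); exact: SB. Qed.
Let SN x : S x -> S (- x). Proof. by rewrite -sub0r; exact: SB. Qed.
Let SD x y : S x -> S y -> S (x + y).
Proof. by move=> Sx Sy; rewrite -[y]opprK; apply/SB/SN. Qed.

Local Ltac in_S := repeat first [assumption | apply: SM | apply: SB | apply: SN | apply: SD].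

Lemma unit_regular_in_unitl u x :
  S x -> is_unit_of S 1 u -> unit_regular_in S (u * x) -> unit_regular_in S x.
Proof.
move=> Sx [Su [u' Su' [uu' u'u]]] [y [Sy [z Sz [yz zy]]] xE].
exists (y * u).
  split; first by in_S.
  exists (u' * z); first by in_S.
  by split; rewrite mulrA -[X in X * _]mulrA ?uu' ?zy mulr1.
by rewrite -[LHS]mul1r -u'u -mulrA xE !mulrA u'u mul1r.
Qed.

Lemma unit_regular_in_unitr u x :
  S x -> is_unit_of S 1 u -> unit_regular_in S (x * u) -> unit_regular_in S x.
Proof.
move=> Sx [Su [u' Su' [uu' u'u]]] [y [Sy [z Sz [yz zy]]] xE].
exists (u * y).
  split; first by in_S.
  exists (z * u'); first by in_S.
  by split; rewrite mulrA -[X in X * _]mulrA ?u'u ?yz mulr1.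
by rewrite -[LHS]mulr1 -uu' mulrA xE -!mulrA uu' mulr1 !mulrA.
Qed.

Lemma unit_regular_in_idempotent g : g * g = g -> unit_regular_in S g.
Proof.
by move=> gg; exists 1; [split=> //; exists 1; rewrite ?mulr1|rewrite mulr1 gg].
Qed.

Lemma is_unit_of_nilpotent x : S x -> x * x = 0 -> is_unit_of S 1 (1 + x).
Proof.
move=> Sx xx; split; first by in_S.
exists (1 - x); first by in_S.
split; first by rewrite mulrBr mulr1 mulrDl mul1r xx addr0 addrK.
by rewrite mulrDr mulr1 mulrBl mul1r xx subr0 subrK.
Qed.

(** * Adding an element of rank one to a unit-regular element *)

Section RankOne.
Context (e : R) (eprim : primitive S e).

Let Se : S e. Proof. by case: eprim. Qed.
Let ee : e * e = e. Proof. by case: eprim. Qed.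

(** The two halves of [primitive] give a left inverse [y] and a right inverse [z] of [x]. They agree
    in the corner: [ye = y(xz) = (yx)z = ez]. *)
Lemma primitive_corner_inv x : S x -> e * x = x -> x * e = x -> x != 0 ->
  exists2 y, S y & [/\ e * y = y, y * e = y, y * x = e & x * y = e].
Proof.
move=> Sx ex xe x0; case: eprim => _ _ /(_ _ Sx xe x0)[y Sy [ey yx]].
move=> /(_ _ Sx ex x0)[z Sz [ze xz]].
have yez : y * e = e * z by rewrite -[in LHS]xz mulrA yx.
have yexe : y * e * x = e by rewrite -mulrA ex.
exists (y * e); first by in_S.
split=> //; first by rewrite mulrA ey.
- by rewrite -mulrA ee.
- by rewrite yez mulrA xe.
Qed.

(** Sherman-Morrison formula: if [y] inverts [e + wv] in the division corner, then [1 - vyw] inverts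
    [1 + vw]. *)
Lemma is_unit_of_rank_one v w : S v -> S w -> v * e = v -> e * w = w ->
  e + w * v != 0 -> is_unit_of S 1 (1 + v * w).
Proof.
move=> Sv Sw ve ew wv0.
have [|||y Sy [ey ye yl ly]] := primitive_corner_inv _ _ _ wv0.
- by in_S.
- by rewrite mulrDr ee mulrA ew.
- by rewrite mulrDl ee -mulrA ve.
split; first by in_S.
exists (1 - v * y * w); first by in_S.
move: yl ly; rewrite mulrDl mulrDr ye ey => yl ly.
have E1 : v * w * (v * y * w) = v * (w * v * y) * w by rewrite !mulrA.
have E2 : v * y * w * (v * w) = v * (y * (w * v)) * w by rewrite !mulrA.
split.
  rewrite mulrBr mulr1 mulrDl mul1r E1 -mulrDl -mulrDr ly.
  by rewrite ve addrK.
by rewrite mulrDr mulr1 mulrBl mul1r E2 -addrA (addrCA (- _)) -opprD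
  -mulrDl -mulrDr yl ve subrr addr0.
Qed.

(** Take [y], [z] with [yv = e], [yg = 0], [wz = e], [gz = 0]. Then [1 + (z - v)y] fixes [g] and
    sends [v] to [z], and [g + zw] is idempotent. Since [e + y(z - v) = yz], this factor is a unit
    once [yz] is nonzero. *)
Lemma unit_regular_in_idempotentD_corner g v w :
  S g -> g * g = g -> S v -> S w -> v * e = v -> e * w = w ->
  g * v = 0 -> w * g = 0 -> unit_regular_in S (g + v * w).
Proof.
move=> Sg gg Sv Sw ve ew gv wg.
have [->|v0] := eqVneq v 0.
  by rewrite mul0r addr0; exact: unit_regular_in_idempotent.
have [->|w0] := eqVneq w 0.
  by rewrite mulr0 addr0; exact: unit_regular_in_idempotent.
have e0 : e != 0 by apply: contra_neq v0 => e0; rewrite -ve e0 mulr0.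
have [_ _ /(_ _ Sv ve v0)[y' Sy' [ey' y'v]] /(_ _ Sw ew w0)[z' Sz' [z'e wz']]] := eprim.
(* The factors [1 - g] make [y] and [z1] orthogonal to [g]; as [gv = 0] and [wg = 0], the relations
   [yv = e] and [wz1 = e] survive. *)
pose y := y' * (1 - g); pose z1 := (1 - g) * z'.
have Sy : S y by rewrite /y; in_S.
have Sz1 : S z1 by rewrite /z1; in_S.
have ey : e * y = y by rewrite mulrA ey'.
have z1e : z1 * e = z1 by rewrite -mulrA z'e.
have yv : y * v = e by rewrite -mulrA mulrBl mul1r gv subr0.
have wz1 : w * z1 = e by rewrite mulrA mulrBr mulr1 wg subr0.
have yg : y * g = 0 by rewrite -mulrA mulrBl mul1r gg subrr mulr0.
have gz1 : g * z1 = 0 by rewrite mulrA mulrBr mulr1 gg subrr mul0r.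
(* If [y z1 = 0], the remedy comes from [v], on which [y] does not vanish: add [v] to [z1] when
   [wv = 0], otherwise rescale [v] by the inverse [l] of [wv]. *)
have [z [Sz ze gz] [wz yz]] : exists2 z, [/\ S z, z * e = z & g * z = 0] &
    w * z = e /\ y * z != 0.
  have [yz1|] := eqVneq (y * z1) 0; last by exists z1.
  have [wv|wv] := eqVneq (w * v) 0.
    exists (z1 + v); first by split; [in_S|rewrite mulrDl ve z1e|rewrite mulrDr gv gz1 addr0].
    by rewrite !mulrDr wz1 wv yz1 yv addr0 add0r.
  have [|||l Sl [el le lw wl]] := primitive_corner_inv _ _ _ wv.
  - by in_S.
  - by rewrite mulrA ew.
  - by rewrite -mulrA ve.
  exists (v * l); first by split; [in_S|rewrite -mulrA le|rewrite mulrA gv mul0r].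
  rewrite !mulrA yv el; split=> //.
  by apply: contra_neq e0 => l0; rewrite -wl l0 mulr0.
exists (1 + (z - v) * y).
  apply: is_unit_of_rank_one => //; first by in_S.
    by rewrite mulrBl ze ve.
  by rewrite mulrBr yv addrC subrK.
rewrite -mulrA.
have -> : (1 + (z - v) * y) * (g + v * w) = g + z * w.
  rewrite mulrDl mul1r -mulrA mulrDr yg add0r (mulrA y) yv ew mulrBl.
  by rewrite addrACA subrr addr0.
rewrite mulrDr !mulrDl gg mulrA gz mul0r add0r -!mulrA wg mulr0 addr0.
by rewrite (mulrA w) wz ew.
Qed.

(* Unless [v = gv], some [y] with [yg = 0] and [yv = e] makes [1 - gvy] a unit
   that turns [v] into [(1 - g)v]; dually for [w].  Four block cases remain. *)
Lemma unit_regular_in_idempotentD g v w :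
  S g -> g * g = g -> S v -> S w -> v * e = v -> e * w = w ->
  unit_regular_in S (g + v * w).
Proof.
move=> Sg gg Sv Sw ve ew.
have g'g : (1 - g) * g = 0 by rewrite mulrBl mul1r gg subrr.
have gg' : g * (1 - g) = 0 by rewrite mulrBr mulr1 gg subrr.
wlog gv : v Sv ve / g * v = 0 \/ g * v = v => [wl|].
  have [gv|gv] := eqVneq ((1 - g) * v) 0.
    by apply: wl => //; right; apply/eqP; rewrite eq_sym -subr_eq0 -[X in X - _]mul1r -mulrBl gv.
  case: eprim => _ _ /(_ ((1 - g) * v))[||//|y Sy [ey yv] _]; first by in_S.
    by rewrite -mulrA ve.
  have yg : y * (1 - g) * g = 0 by rewrite -mulrA g'g mulr0.
  apply: (@unit_regular_in_unitl (1 + - (g * v * (y * (1 - g))))); first by in_S.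
    apply: is_unit_of_nilpotent; first by in_S.
    by rewrite mulrNN -!mulrA (mulrA (1 - g) g) g'g mul0r !mulr0.
  rewrite mulrDl mul1r mulNr [X in _ - X]mulrDr.
  rewrite -[X in _ - (X + _)]mulrA yg mulr0 add0r.
  have -> : g * v * (y * (1 - g)) * (v * w) = g * v * (y * ((1 - g) * v)) * w by rewrite !mulrA.
  rewrite yv -[g * v * e]mulrA ve -addrA -mulrBl -[X in X - _]mul1r -mulrBl.
  apply: wl; [by in_S|by rewrite -mulrA ve|left].
  by rewrite mulrA gg' mul0r.
wlog wg : w Sw ew / w * g = 0 \/ w * g = w => [wl|].
  have [wg|wg] := eqVneq (w * (1 - g)) 0.
    by apply: wl => //; right; apply/eqP; rewrite eq_sym -subr_eq0 -[X in X - _]mulr1 -mulrBr wg.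
  case: eprim => _ _ _ /(_ (w * (1 - g)))[||//|y Sy [ye wy]]; first by in_S.
    by rewrite mulrA ew.
  have gy : g * ((1 - g) * y) = 0 by rewrite mulrA gg' mul0r.
  apply: (@unit_regular_in_unitr (1 + - ((1 - g) * y * (w * g)))); first by in_S.
    apply: is_unit_of_nilpotent; first by in_S.
    by rewrite mulrNN -!mulrA (mulrA g (1 - g)) gg' mul0r !mulr0.
  rewrite mulrDr mulr1 mulrN [X in _ - X]mulrDl.
  rewrite [X in _ - (X + _)]mulrA gy mul0r add0r.
  have -> : v * w * ((1 - g) * y * (w * g)) = v * (w * (1 - g) * y) * (w * g) by rewrite !mulrA.
  rewrite wy ve -addrA -mulrBr -[X in X - _]mulr1 -mulrBr.
  apply: wl; [by in_S|by rewrite mulrA ew|left].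
  by rewrite -mulrA g'g mulr0.
case: gv wg => gv [] wg; first exact: unit_regular_in_idempotentD_corner.
(* Here [gv = 0] and [wg = w], so [wv = wgv = 0]: [vw] has square zero, and the unit [1 - vw] clears
   it from [g + vw] on the left. *)
- apply: (@unit_regular_in_unitl (1 + - (v * w))); first by in_S.
    apply: is_unit_of_nilpotent; first by in_S.
    by rewrite mulrNN -mulrA -wg -(mulrA w g) (mulrA g) gv mul0r !mulr0.
  rewrite mulrDl mul1r mulNr mulrDr -!mulrA wg.
  have -> : v * (w * (v * w)) = 0 by rewrite -wg -(mulrA w g) (mulrA g) gv mul0r !mulr0.
  by rewrite addr0 addrK; exact: unit_regular_in_idempotent.
(* The dual case [gv = v], [wg = 0]: again [wv = 0], and the clearing takes place on the right. *)
- apply: (@unit_regular_in_unitr (1 + - (v * w))); first by in_S.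
    apply: is_unit_of_nilpotent; first by in_S.
    by rewrite mulrNN -mulrA -gv (mulrA w (g * v)) (mulrA w g) wg !mul0r !mulr0.
  rewrite mulrDr mulr1 mulrN mulrDl !mulrA gv.
  have -> : v * w * v * w = 0 by rewrite -!mulrA -gv (mulrA w (g * v)) (mulrA w g) wg !mul0r !mulr0.
  by rewrite addr0 addrK; exact: unit_regular_in_idempotent.
(* Now [gv = v] and [wg = w]. Either [wv = -e], and [g + vw] is idempotent, or [1 + vw] is a unit
   and [g + vw = g(1 + vw)]. *)
have [e0|e0] := eqVneq (e + w * v) 0.
  apply: unit_regular_in_idempotent.
  rewrite mulrDr !mulrDl gg -[v * w * g]mulrA wg [g * _]mulrA gv.
  have -> : v * w * (v * w) = v * (w * v) * w by rewrite !mulrA.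
  have -> : w * v = - e by apply/eqP; rewrite -addr_eq0 addrC e0.
  by rewrite mulrN mulNr ve subrr addr0.
have -> : g + v * w = g * (1 + v * w) by rewrite mulrDr mulr1 mulrA gv.
have [Su [u' Su' [uu' u'u]]] := is_unit_of_rank_one Sv Sw ve ew e0.
apply: (@unit_regular_in_unitr u'); first by in_S.
  by split=> //; exists (1 + v * w).
by rewrite -mulrA uu' mulr1; exact: unit_regular_in_idempotent.
Qed.

(** If [x = xyx] with [y] a unit, left multiplication by [y] turns [x] into the idempotent [yx] and
    [ew] into the product of [ye] and [ew]. *)
Lemma unit_regular_inD_primitive x w :
  S x -> S w -> unit_regular_in S x -> unit_regular_in S (x + e * w).
Proof.
move=> Sx Sw [y [Sy [z Sz [yz zy]]] xE].
apply: (@unit_regular_in_unitl y); [by in_S|by split=> //; exists z|].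
have -> : y * (x + e * w) = y * x + y * e * (e * w).
  by rewrite mulrDr -(mulrA y e) (mulrA e e) ee.
apply: unit_regular_in_idempotentD; try by in_S.
- by rewrite -mulrA (mulrA x) -xE.
- by rewrite -mulrA ee.
- by rewrite mulrA ee.
Qed.

End RankOne.

(* With [b = ewe] an inner inverse of [a] in the corner, [n = w - wxw] maps the
   cokernel of [a] isomorphically onto its kernel, so [bab + n] is a unit. *)
Lemma unit_regular_in_corner e a : S e -> e * e = e -> S a ->
  e * a = a -> a * e = a -> unit_regular_in S (a + (1 - e)) ->
  exists2 y, S y & [/\ e * y = y, y * e = y, a = a * y * a &
    exists2 z, S z & [/\ e * z = z, z * e = z, y * z = e & z * y = e]].
Proof.
move=> Se ee Sa ea ae [w [Sw [w' Sw' [ww' w'w]]]].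
set f := 1 - e; set x := a + f => xE.
have Sf : S f by rewrite /f; in_S.
have Sx : S x by rewrite /x; in_S.
have fa : f * a = 0 by rewrite mulrBl mul1r ea subrr.
have af : a * f = 0 by rewrite mulrBr mulr1 ae subrr.
have ff : f * f = f by rewrite mulrBr mulr1 mulrBl mul1r ee subrr subr0.
have ef : e * f = 0 by rewrite mulrBr mulr1 ee subrr.
have fe : f * e = 0 by rewrite mulrBl mul1r ee subrr.
have fx : f * x = f by rewrite mulrDr fa ff add0r.
have xf : x * f = f by rewrite mulrDl af ff add0r.
have ex : e * x = a by rewrite mulrDr ef addr0.
have xe : x * e = a by rewrite mulrDl fe addr0.
have fE z : f * z = 0 -> e * z = z.
  by rewrite mulrBl mul1r => /eqP; rewrite subr_eq0 => /eqP <-.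
have Ef z : z * f = 0 -> z * e = z.
  by rewrite mulrBr mulr1 => /eqP; rewrite subr_eq0 => /eqP <-.
pose b := e * w * e.
have Sb : S b by rewrite /b; in_S.
have aba : a * b * a = a.
  have -> : a * b * a = e * (x * w * x) * e.
    by rewrite /b !mulrA ae ex -(mulrA _ e a) ea -(mulrA _ x e) xe.
  by rewrite -xE ex ae.
have eb : e * b = b by rewrite /b !mulrA ee.
have be : b * e = b by rewrite /b -!mulrA ee.
clearbody b.
pose n := w - w * x * w.
have Sn : S n by rewrite /n; in_S.
have xn : x * n = 0 by rewrite mulrBr !mulrA -xE subrr.
have nx : n * x = 0 by rewrite mulrBl -!mulrA (mulrA x) -xE subrr.
have fn : f * n = 0 by rewrite -fx -mulrA xn mulr0.
have nf : n * f = 0 by rewrite -xf mulrA nx mul0r.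
have en := fE _ fn; have ne := Ef _ nf.
have an : a * n = 0 by rewrite -en mulrA ae -ex -mulrA xn mulr0.
have na : n * a = 0 by rewrite -xe mulrA nx mul0r.
(* Within the corner, [p] projects onto the kernel of [a], and [q] onto a complement of its
   image. *)
pose p := e - b * a; pose q := e - a * b.
have ep : e * p = p by rewrite mulrBr ee mulrA eb.
have pe : p * e = p by rewrite mulrBl ee -mulrA ae.
have eq : e * q = q by rewrite mulrBr ee mulrA ea.
have qe : q * e = q by rewrite mulrBl ee -mulrA be.
have ap : a * p = 0 by rewrite mulrBr ae mulrA aba subrr.
have qa : q * a = 0 by rewrite mulrBl ea aba subrr.
have pn : p * n = n by rewrite mulrBl en -mulrA an mulr0 subr0.
have nq : n * q = n by rewrite mulrBr ne mulrA na mul0r subr0.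
have xp : x * p = 0 by rewrite -ep mulrA xe ap.
have qx : q * x = 0 by rewrite -qe -mulrA ex qa.
(* [l] inverts [n] between these two summands: [nl = p] and [ln = q]. *)
pose l := q * w' * p.
have nl : n * l = p.
  have nw' : n * w' = 1 - w * x by rewrite mulrBl -[w * x * w * w']mulrA ww' mulr1.
  by rewrite /l !mulrA nq nw' mulrBl mul1r -mulrA xp mulr0 subr0.
have ln : l * n = q.
  rewrite /l -mulrA pn mulrBr -!mulrA w'w mulr1.
  by rewrite (mulrA w') w'w mul1r (mulrA q) qx mul0r subr0.
have Sl : S l by rewrite /l /p /q; in_S.
have el : e * l = l by rewrite /l !mulrA eq.
have le : l * e = l by rewrite /l -!mulrA pe.
have baba : b * a * b * a = b * a by rewrite -[RHS](congr1 (fun z => b * z) aba) !mulrA.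
have bq : b * a * b * q = 0 by rewrite mulrBr -(mulrA _ b e) be !mulrA baba subrr.
have pb : p * (b * a * b) = 0 by rewrite mulrBl !mulrA eb baba subrr.
have bl : b * a * b * l = 0 by rewrite /l !mulrA bq !mul0r.
have lb : l * (b * a * b) = 0 by rewrite /l -(mulrA _ p) pb mulr0.
clearbody n l.
(* Unlike [b], the inner inverse [bab] is annihilated by [q] on the right and by [p] on the left, so
   it does not interact with [l], and [a + l] is the inverse. *)
exists (b * a * b + n); first by in_S.
split.
- by rewrite mulrDr en !mulrA eb.
- by rewrite mulrDl ne -!mulrA be.
- by rewrite mulrDr an addr0 !mulrA aba aba.
exists (a + l); first by in_S.
split; first by rewrite mulrDr ea el.
- by rewrite mulrDl ae le.
- rewrite mulrDr !mulrDl na nl addr0 bl add0r baba.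
  by rewrite addrC subrK.
- rewrite mulrDr !mulrDl an ln add0r lb addr0 !mulrA aba.
  by rewrite addrC subrK.
Qed.

End UnitalSubring.

(** * Multiplication of the images of psi *)

Section MatrixUnit.
Context {K : fieldType} {X : choiceType}.
Implicit Types (a : CFM K X) (r s x y : X).

Let mxunit_cf r s : column_finite (fun x y => ((x == r) && (y == s))%:R : K).
Proof.
move=> y; apply: (@sub_finite_set _ _ [set r]); last exact: finite_set1.
by move=> x /=; case: (eqVneq x r) => //= _; rewrite eqxx.
Qed.

Definition mxunit r s : CFM K X := cfm (mxunit_cf r s).

Lemma fsbig_support1 (F : X -> K) z0 : (forall z, z != z0 -> F z = 0) ->
  \sum_(z \in [set: X]) F z = F z0.
Proof.
move=> F0; rewrite (fsbigTE [fset z0]%fset) ?big_seq_fset1// => z.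
by rewrite inE; exact: F0.
Qed.

Lemma mul_mxunitE r s a x y : (mxunit r s * a) x y = (x == r)%:R * a s y.
Proof.
rewrite cfm_mulE (fsbig_support1 (z0 := s)) /=; first by rewrite eqxx andbT.
by move=> z /negbTE zs; rewrite zs andbF mul0r.
Qed.

Lemma mul_mxunitrE r s a x y : (a * mxunit r s) x y = a x r * (y == s)%:R.
Proof.
rewrite cfm_mulE (fsbig_support1 (z0 := r)) /=; first by rewrite eqxx.
by move=> z /negbTE zs; rewrite zs mulr0.
Qed.

Lemma cfm_scaleE k a x y : (k *: a) x y = k * a x y. Proof. by []. Qed.

Lemma cfm_scale1_mul k a : (k *: (1 : CFM K X)) * a = k *: a.
Proof.
apply: cfm_ext => x y; rewrite cfm_mulE (fsbig_support1 (z0 := x)).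
  by rewrite !cfm_scaleE cfm_oneE eqxx mulr1.
by move=> z zx; rewrite cfm_scaleE cfm_oneE eq_sym (negbTE zx) mulr0 mul0r.
Qed.

Lemma cfm_mul_scale1 k a : a * (k *: (1 : CFM K X)) = k *: a.
Proof.
apply: cfm_ext => x y; rewrite cfm_mulE (fsbig_support1 (z0 := y)).
  by rewrite !cfm_scaleE cfm_oneE eqxx mulr1 mulrC.
by move=> z zy; rewrite cfm_scaleE cfm_oneE (negbTE zy) !mulr0.
Qed.

Lemma cfm_scalerAl k a b : k *: (a * b) = (k *: a) * b :> CFM K X.
Proof. by rewrite -cfm_scale1_mul mulrA cfm_scale1_mul. Qed.

Lemma cfm_scalerAr k a b : k *: (a * b) = a * (k *: b) :> CFM K X.
Proof. by rewrite -cfm_mul_scale1 -mulrA cfm_mul_scale1. Qed.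

Lemma cfm_mul_neq0 a b x y :
  (a * b) x y != 0 -> exists2 z, a x z != 0 & b z y != 0.
Proof.
rewrite cfm_mulE; apply: contra_neqP => abN; apply: fsbig1 => z _.
apply/eqP; rewrite mulf_eq0 -[_ || _]negbK negb_or; apply/negP => /andP[axz bzy].
by apply: abN; exists z.
Qed.

Lemma mxunit_FR r s : FR K X (mxunit r s).
Proof.
apply: (@sub_finite_set _ _ [set r]); last exact: finite_set1.
by move=> x /= [y]; case: (eqVneq x r) => //= _; rewrite eqxx.
Qed.

(** Column-finiteness of [b] enters here: the nonzero rows of [b * a] lie in the supports of the
    finitely many columns of [b] indexed by nonzero rows of [a]. *)
Lemma FR_mull a b : FR K X a -> FR K X (b * a).
Proof.
move=> afin; apply: (@sub_finite_set _ _
    (\bigcup_(z in [set z | exists y, a z y != 0]) [set x | b x z != 0])).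
  by move=> x [y /cfm_mul_neq0[z bxz azy]]; exists z => //; exists y.
by apply: bigcup_finite => // z _; exact: cfmP.
Qed.

Lemma FR_mulr a b : FR K X a -> FR K X (a * b).
Proof.
by apply: sub_finite_set => x [y /cfm_mul_neq0[z axz _]]; exists z.
Qed.

Lemma FR_sub a b : FR K X a -> FR K X b -> FR K X (a - b).
Proof.
move=> afin bfin; apply: (@sub_finite_set _ _ ([set x | exists y, a x y != 0] `|`
    [set x | exists y, b x y != 0])); last by rewrite finite_setU.
move=> x [y]; have [ax|ax _] := eqVneq (a x y) 0; last by left; exists y.
have -> : (a - b) x y = a x y - b x y by [].
by rewrite ax sub0r oppr_eq0 => bx; right; exists y.
Qed.

End MatrixUnit.

(** * Classes of linked indices and the block structure of [psi] *)

Section Psi.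
Context {d : Order.disp_t} {aleph : bOrderType d} {K : fieldType}.
Context {d' : Order.disp_t} {I : porderType d'}.
Implicit Types (i j : I) (x y z : Xindex aleph I).

Local Notation chain x := (val x.2).

Lemma linked_sym i x y : linked i x y -> linked i y x.
Proof. by move=> [e f]; split=> // k /f. Qed.

Lemma linked_trans i x y z : linked i x y -> linked i y z -> linked i x z.
Proof. by move=> [e f] [e' f']; split=> [|k ik]; rewrite ?e ?f ?f'. Qed.

Lemma linked_chain i j x y : linked i x y -> (j <= i)%O -> chain x j -> chain y j.
Proof.
move=> [xy _] ji xj.
have : (chain x `&` [set k | (k <= i)%O]) j by [].
by rewrite xy => -[].
Qed.

Lemma linked_le i j x y : (i <= j)%O -> linked j x y -> linked i x y.
Proof.
move=> ij xy; split=> [|k ik].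
  by apply/seteqP; split=> k [] /= + ki; have kj := le_trans ki ij;
    split=> //; [apply: linked_chain xy _ _|apply: linked_chain (linked_sym xy) _ _].
by apply: xy.2; apply: contra ik; exact: le_trans.
Qed.

Lemma chain_total x i j : chain x i -> chain x j -> (i <= j)%O || (j <= i)%O.
Proof.
by move=> xi xj; have [/(_ _ _ xi xj)[->|->] _] := set_mem (valP x.2); rewrite ?orbT.
Qed.

Lemma eq_restr_chain i k x y (xi : chain x i) (yi : chain y i) :
  restr xi = restr yi -> (i <= k)%O -> chain x k -> chain y k.
Proof.
move=> [_ +] ik xk => /(congr1 (fun f => f (exist _ k ik : upset i))).
by rewrite /trace /= => <-.
Qed.

Lemma eq_restr_map i k x y (xi : chain x i) (yi : chain y i) :
  restr xi = restr yi -> (i <= k)%O -> val x.1 k = val y.1 k.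
Proof.
by move=> [+ _] ik => /(congr1 (fun f => f (exist _ k ik : upset i))).
Qed.

Lemma eq_restr i x y (xi : chain x i) (yi : chain y i) :
  (forall k, (i <= k)%O -> val x.1 k = val y.1 k) ->
  (forall k, (i <= k)%O -> chain x k <-> chain y k) ->
  restr xi = restr yi.
Proof.
move=> xy1 xy2; congr pair; apply: val_inj.
  by apply/funext => k /=; apply: xy1; exact: valP.
by apply/funext => k /=; apply/propext; apply: xy2; exact: valP.
Qed.

Lemma psiE i (a : CFM K (Xindex aleph (upset i))) x y (xi : chain x i) (yi : chain y i) :
  linked i x y -> psi a x y = a (restr xi) (restr yi).
Proof.
move=> xy; rewrite /= /psi_fun; case: pselect => // xi'; case: pselect => // yi'.
by case: pselect => // xy'; rewrite (Prop_irrelevance xi' xi) (Prop_irrelevance yi' yi).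
Qed.

Lemma psi_neq0 i (a : CFM K (Xindex aleph (upset i))) x y :
  psi a x y != 0 -> [/\ chain x i, chain y i & linked i x y].
Proof.
rewrite /= /psi_fun; case: pselect => [xi|]; last by rewrite eqxx.
case: pselect => [yi|]; last by rewrite eqxx.
by case: pselect => [xy|]; rewrite ?eqxx.
Qed.

Lemma psi_eq0 i (a : CFM K (Xindex aleph (upset i))) x y :
  ~ (chain x i /\ chain y i /\ linked i x y) -> psi a x y = 0.
Proof. by move=> xyN; apply/eqP; apply: contra_notT xyN => /psi_neq0[]. Qed.

(** Splicing: take [u] above [i] and [z] elsewhere, for the map and for the chain. With
    [restr_linked_inj], this makes [restr] a bijection from the linked class of [z] onto the indices
    of [upset i]. *)
Lemma restr_surj i z (u : Xindex aleph (upset i)) : chain z i ->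
  exists x (xi : chain x i), restr xi = u /\ linked i x z.
Proof.
move=> zi.
pose p k := if insub k is Some k' then val u.1 (k' : upset i) else val z.1 k.
have pfin : p \in @finsupp_maps _ aleph _ I.
  apply/mem_set; apply: (@sub_finite_set _ _
    ((val @` [set a | val u.1 a != \bot%O]) `|` [set a | val z.1 a != \bot%O])).
    move=> k; rewrite /= /p; case: insubP => [k' ik kk|_]; last by right.
    by left; exists k'.
  rewrite finite_setU; split; last exact: set_mem (valP z.1).
  exact/finite_image/(set_mem (valP u.1)).
have [uchain umax] := set_mem (valP u.2).
have [zchain zmax] := set_mem (valP z.2).
(* [i] is the least element of [upset i], so it can be added to any chain there, and a maximal chain
   contains it. *)
have ui : val u.2 (exist _ i (lexx i) : upset i).
  have := umax (val u.2 `|` [set (exist _ i (lexx i) : upset i)]).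
  move=> <-; first by right.
    move=> k l [uk|->] [ul|->]; first exact: uchain.
    - by right; exact: (valP k).
    - by left; exact: (valP l).
    - by left.
  by move=> k; left.
pose C : set I := (chain z `&` [set k | (k <= i)%O]) `|` (val @` val u.2).
have Ci : C i by left; split=> /=.
have Cle k : (k <= i)%O -> C k -> chain z k.
  move=> ki [[]//|[l _ lk]].
  suff -> : k = i by [].
  by apply/eqP; rewrite eq_le ki -lk (valP l).
have Cup (k : upset i) : C (val k) -> val u.2 k.
  move=> [[_ /= ki]|[l ul /val_inj <-//]].
  suff -> : k = exist _ i (lexx i) by [].
  by apply: val_inj; apply/eqP; rewrite eq_le ki (valP k).
have Cmax : C \in maximal_chains I.
  apply/mem_set; split.
    move=> k l [[zk ki]|[k' uk <-]] [[zl li]|[l' ul <-]]; first exact: zchain.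
    - by left; exact: le_trans ki (valP l').
    - by right; exact: le_trans li (valP k').
    - exact: (uchain k' l').
  move=> E Echain CE; apply/seteqP; split=> // k Ek.
  have [ki|ik] := Echain _ _ Ek (CE _ Ci).
    left; split=> //.
    (* The part of [E] below [i], continued by the chain of [z] above [i], is a chain containing
       that of [z], hence equal to it. *)
    rewrite -(zmax ((E `&` [set k | (k <= i)%O]) `|` (chain z `&` [set k | (i <= k)%O]))).
    - by left.
    - move=> m n [[Em mi]|[zm im]] [[En ni]|[zn in_]]; first exact: Echain.
      + by left; exact: le_trans mi in_.
      + by right; exact: le_trans ni im.
      + exact: zchain.
    - move=> m zm; have [mi|im] := orP (chain_total zm zi); last by right.
      by left; split=> //; apply: CE; left.
  right; exists (exist _ k ik : upset i) => //.
  rewrite -(umax [set m | E (val m)])//.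
    by move=> m n Em En; exact: Echain.
  by move=> m um; apply: CE; right; exists m.
exists (SigSub pfin, SigSub Cmax), Ci; split.
  case: u @p pfin @C Ci Cle Cup Cmax {uchain umax ui} => u1 u2 p pfin C Ci Cle Cup Cmax.
  congr pair; apply: val_inj.
    apply/funext => k /=; rewrite /p; case: insubP => [k' _ /val_inj ->//|].
    by rewrite (valP k).
  apply/seteqP; split=> k /=; first exact: Cup.
  by move=> uk; right; exists k.
split=> [|k ik] /=.
  apply/seteqP; split=> k [] /=.
    by move=> Ck ki; split=> //; exact: Cle.
  by move=> zk ki; split=> //; left.
by rewrite /p insubN.
Qed.

(** Only the linked class of [y] contributes on the left, and [restr] carries this class bijectively
    onto the index set on the right. *)
Lemma fsbig_linked i y (F : Xindex aleph I -> K) (G : Xindex aleph (upset i) -> K) :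
  chain y i -> (forall z, F z != 0 -> chain z i /\ linked i z y) ->
  (forall z (zi : chain z i), linked i z y -> F z = G (restr zi)) ->
  \sum_(z \in [set: Xindex aleph I]) F z =
  \sum_(u \in [set: Xindex aleph (upset i)]) G u.
Proof.
move=> yi F0 FG.
pose h u := sval (cid (@restr_surj i y u yi)).
have hP u : exists zi : chain (h u) i, restr zi = u /\ linked i (h u) y.
  by rewrite /h; case: cid.
have hbij : set_bij [set: Xindex aleph (upset i)]
    [set z | chain z i /\ linked i z y] h.
  split.
  - by move=> u _; have [zi [_ zy]] := hP u.
  - move=> u v _ _ uv; have [zi [<- _]] := hP u; have [zi' [<- _]] := hP v.
    by case: _ / uv zi' => zi'; rewrite (Prop_irrelevance zi zi').
  - move=> z /= [zi zy]; exists (restr zi) => //.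
    have [hi [hz hy]] := hP (restr zi).
    exact: restr_linked_inj hz (linked_trans hy (linked_sym zy)).
rewrite -(@fsbig_widen _ _ _ _ [set z | chain z i /\ linked i z y])//; last first.
  by move=> z [_ zN] /=; apply/eqP; apply: contra_notT zN => /F0.
rewrite (reindex_fsbig h _ _ _ hbij); apply: eq_fsbigr => u _.
by have [zi [uE zy]] := hP u; rewrite (FG _ zi zy) uE.
Qed.

(** [psi a] is block diagonal, with one copy of [a] on each linked class of indices whose chains
    contain [i]; the blocks multiply separately. *)
Lemma psi_mul i (a b : CFM K (Xindex aleph (upset i))) : psi (a * b) = psi a * psi b.
Proof.
apply: cfm_ext => x y.
have [[xi [yi xy]]|xyN] := pselect (chain x i /\ chain y i /\ linked i x y).
  rewrite (psiE _ xi yi xy) !cfm_mulE; apply/esym/(@fsbig_linked i y) => //.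
    move=> z; rewrite mulf_eq0 negb_or => /andP[_ /psi_neq0[zi _ zy]].
    by split.
  by move=> z zi zy; rewrite (psiE _ xi zi (linked_trans xy (linked_sym zy))) (psiE _ zi yi zy).
rewrite (psi_eq0 _ xyN); apply/esym/eqP; apply: contra_notT xyN => /cfm_mul_neq0[z].
by move=> /psi_neq0[xi _ xz] /psi_neq0[_ yi zy]; do 2!split=> //; exact: linked_trans zy.
Qed.

Section SameRestriction.
Context (i j : I) (x y x' y' : Xindex aleph I).
Context (xi : chain x i) (yi : chain y i) (xi' : chain x' i) (yi' : chain y' i).
Context (ij : (i <= j)%O) (ex : restr xi = restr xi') (ey : restr yi = restr yi').
Context (xy' : linked i x' y').

(** Below [i] the agreement of [x'] and [y'] comes from [xy']; above [i] it is visible on the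
    restrictions, which are those of [x] and [y]. *)
Lemma linked_restr : linked j x y -> linked j x' y'.
Proof.
move=> jxy; split=> [|k jk].
  apply/seteqP; split=> k /= [kk kj]; split=> //.
    have [ki|ik] := orP (chain_total kk xi'); first exact: linked_chain xy' ki kk.
    by apply: (eq_restr_chain ey ik _); apply: (linked_chain jxy kj _);
      apply: (eq_restr_chain (esym ex) ik kk).
  have [ki|ik] := orP (chain_total kk yi'); first exact: linked_chain (linked_sym xy') ki kk.
  by apply: (eq_restr_chain ex ik _); apply: (linked_chain (linked_sym jxy) kj _);
    apply: (eq_restr_chain (esym ey) ik kk).
have [ik|ik] := boolP (i <= k)%O; last exact: xy'.2.
by rewrite -(eq_restr_map ex ik) -(eq_restr_map ey ik) jxy.2.
Qed.

Lemma psi_eq_restr (b : CFM K (Xindex aleph (upset j))) :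
  psi b x y != 0 -> psi b x y = psi b x' y'.
Proof.
move=> /psi_neq0[xj yj jxy].
have xj' := eq_restr_chain ex ij xj; have yj' := eq_restr_chain ey ij yj.
rewrite (psiE _ xj yj jxy) (psiE _ xj' yj' (linked_restr jxy)).
congr (b _ _); apply: eq_restr => k jk; have ik := le_trans ij jk.
- exact: eq_restr_map ex ik.
- by split; [exact: eq_restr_chain ex ik|exact: eq_restr_chain (esym ex) ik].
- exact: eq_restr_map ey ik.
- by split; [exact: eq_restr_chain ey ik|exact: eq_restr_chain (esym ey) ik].
Qed.

End SameRestriction.

(* [c] is the image of [b] under the map [psi] of the poset [upset i]. *)
Lemma psi_restrict i j (b : CFM K (Xindex aleph (upset j))) : (i <= j)%O ->
  exists c : CFM K (Xindex aleph (upset i)),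
    forall x y, chain x i \/ chain y i -> psi b x y = psi c x y.
Proof.
(* If no chain passes through [i], the condition on [x] and [y] is void and [c = 0] will do. *)
move=> ij; have [[z zi]|noz] := pselect (exists z, chain z i); last first.
  by exists 0 => x y xy; exfalso; apply: noz; case: xy; [exists x|exists y].
(* [c] is read off on the single class of [z], where [h] is a section of [restr]; by [psi_eq_restr]
   the other classes carry the same entries. *)
pose h u := sval (cid (@restr_surj i z u zi)).
have hP u : exists zi : chain (h u) i, restr zi = u /\ linked i (h u) z.
  by rewrite /h; case: cid.
have hinj : injective h.
  move=> u v uv; have [ui [<- _]] := hP u; have [vi [<- _]] := hP v.
  by case: _ / uv vi => vi; rewrite (Prop_irrelevance ui vi).
have c_cf : column_finite (fun u v => psi b (h u) (h v)).
  move=> v; have bfin := cfmP (psi b) (h v).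
  by apply: (finite_preimage (f := h)) bfin => ? ? _ _; exact: hinj.
exists (cfm c_cf) => x y.
have [[xi [yi xy]]|xyN] := pselect (chain x i /\ chain y i /\ linked i x y).
  move=> _; rewrite (psiE _ xi yi xy).
  rewrite [RHS](_ : _ = psi b (h (restr xi)) (h (restr yi)))//.
  have [xi' [ex xz]] := hP (restr xi).
  have [yi' [ey yz]] := hP (restr yi).
  have xy' := linked_trans xz (linked_sym yz).
  (* [psi_eq_restr] starts from a nonzero entry, so it is applied from whichever side is nonzero. *)
  have [bxy0|bxyN] := eqVneq (psi b x y) 0.
    have [->|bhN] := eqVneq (psi b (h (restr xi)) (h (restr yi))) 0; first by [].
    by rewrite (psi_eq_restr ij ex ey xy bhN).
  exact: (psi_eq_restr ij (esym ex) (esym ey) xy' bxyN).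
move=> xyi; rewrite [RHS](psi_eq0 _ xyN); apply/eqP; apply: contra_notT xyN => /psi_neq0[xj yj jxy].
have ixy := linked_le ij jxy.
case: xyi => [xi|yi]; do 2?split=> //; first exact: linked_chain jxy ij xi.
exact: linked_chain (linked_sym jxy) ij yi.
Qed.

(** Only middle indices whose chains contain [i] contribute, and there [psi b] coincides with the
    matrix [psi c] of [psi_restrict]. *)
Lemma psi_mul_le i j (b : CFM K (Xindex aleph (upset j))) : (i <= j)%O ->
  exists c, forall a : CFM K (Xindex aleph (upset i)),
    psi a * psi b = psi (a * c) /\ psi b * psi a = psi (c * a).
Proof.
move=> ij; have [c cE] := psi_restrict b ij; exists c => a.
rewrite !psi_mul; split; apply: cfm_ext => x y; rewrite !cfm_mulE;
  apply: eq_fsbigr => z _.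
  have [->|/psi_neq0[_ zi _]] := eqVneq (psi a x z) 0; first by rewrite !mul0r.
  by rewrite cE//; left.
have [->|/psi_neq0[zi _ _]] := eqVneq (psi a z y) 0; first by rewrite !mulr0.
by rewrite cE//; right.
Qed.

(** A nonzero entry would require a middle index whose chain contains both [i] and [j]. *)
Lemma psi_mul_incomparable i j (a : CFM K (Xindex aleph (upset i)))
    (b : CFM K (Xindex aleph (upset j))) :
  ~~ (i <= j)%O -> ~~ (j <= i)%O -> psi a * psi b = 0.
Proof.
move=> ij ji; apply: cfm_ext => x y; apply/eqP.
apply: contraNT ij => /cfm_mul_neq0[z /psi_neq0[_ zi _] /psi_neq0[zj _ _]].
by have := chain_total zi zj; rewrite (negbTE ji) orbF.
Qed.

Lemma psiB i (a b : CFM K (Xindex aleph (upset i))) : psi (a - b) = psi a - psi b.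
Proof.
apply: cfm_ext => x y; have -> : (psi a - psi b) x y = psi a x y - psi b x y by [].
have [[xi [yi xy]]|xyN] := pselect (chain x i /\ chain y i /\ linked i x y).
  by rewrite !(psiE _ xi yi xy).
by rewrite !psi_eq0// subr0.
Qed.

Lemma psi0 i : psi (0 : CFM K (Xindex aleph (upset i))) = 0.
Proof. by rewrite -(subrr 0) psiB subrr. Qed.

(** Linked indices with equal restrictions are equal, so [psi 1] is the diagonal projection onto the
    indices whose chain contains [i]. *)
Lemma psi1E i x y :
  psi (1 : CFM K (Xindex aleph (upset i))) x y = (`[< chain x i >] && (x == y))%:R.
Proof.
case: asboolP => [xi|xiN]; rewrite ?andTb ?andFb; last first.
  by apply/eqP; apply: contra_notT xiN => /psi_neq0[].
have [<-|xy] := eqVneq x y; first by rewrite (psiE _ xi xi) ?cfm_oneE ?eqxx.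
apply/eqP; apply: contra_neqT xy => xy1; have [_ yi xy] := psi_neq0 xy1.
move: xy1; rewrite (psiE _ xi yi xy) cfm_oneE; case: (eqVneq (restr xi) (restr yi)) => [exy _|_]; last by rewrite eqxx.
exact: restr_linked_inj exy xy.
Qed.

Lemma psiZ i k (a : CFM K (Xindex aleph (upset i))) : psi (k *: a) = k *: psi a.
Proof.
apply: cfm_ext => x y; rewrite cfm_scaleE.
have [[xi [yi xy]]|xyN] := pselect (chain x i /\ chain y i /\ linked i x y).
  by rewrite !(psiE _ xi yi xy).
by rewrite !psi_eq0// mulr0.
Qed.
End Psi.

(** * Local unit-regularity of H(I,J) *)

Lemma seq_minimal (d : Order.disp_t) (P : porderType d) (s : seq P) : s != [::] ->
  exists2 i, i \in s & forall j, j \in s -> (j <= i)%O -> j = i.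
Proof.
elim: s => // a [_ _|b s /(_ isT)[i is_ imin] _].
  by exists a; rewrite ?mem_head// => j; rewrite inE => /eqP.
have [ai|ai] := boolP (a < i)%O.
  exists a => [|j]; first exact: mem_head.
  rewrite inE => /predU1P[//|js] ja.
  have ji := imin _ js (le_trans ja (ltW ai)).
  by move: ja; rewrite ji (lt_geF ai).
exists i => [|j]; first by rewrite inE is_ orbT.
rewrite inE => /predU1P[->{j}|js]; last exact: imin.
by rewrite le_eqVlt (negbTE ai) orbF => /eqP.
Qed.

(** * The summands H(I,i) and the algebra they span *)

Section Span.
Context {d : Order.disp_t} {aleph : bOrderType d} {K : fieldType}.
Context {d' : Order.disp_t} {I : porderType d'}.
Implicit Types (i j : I) (J : set I) (x y h : CFM K (Xindex aleph I)).

(** Brings both cases of [H_elt] to the form [psi a], so that closure properties can be checked on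
    [a]. *)
Definition coeff i : set (CFM K (Xindex aleph (upset i))) :=
  [set a | (is_maximal i -> exists k, a = k *: (1 : CFM K (Xindex aleph (upset i)))) /\
           (~ is_maximal i -> FR K (Xindex aleph (upset i)) a)].

Arguments coeff : clear implicits.

Lemma H_eltP i h : H_elt i h <-> exists2 a, coeff i a & h = psi a.
Proof.
rewrite /H_elt; case: pselect => im; split.
- move=> [k _ <-]; exists (k *: (1 : CFM K (Xindex aleph (upset i)))).
    by split=> // _; exists k.
  by rewrite psiZ.
- by move=> [a [/(_ im)[k ->] _] ->]; exists k => //; rewrite psiZ.
- by move=> [a aFR <-]; exists a => //; split.
- by move=> [a [_ /(_ im) aFR] ->]; exists a.
Qed.

Lemma H_eltB i x y : H_elt i x -> H_elt i y -> H_elt i (x - y).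
Proof.
move=> /H_eltP[a [am aN] ->] /H_eltP[b [bm bN] ->]; apply/H_eltP.
exists (a - b); last by rewrite psiB.
split=> [im|iN]; last by apply: FR_sub; [exact: aN|exact: bN].
have [k ->] := am im; have [l ->] := bm im.
by exists (k - l); rewrite scalerBl.
Qed.

Lemma H_elt0 i : H_elt i (0 : CFM K (Xindex aleph I)).
Proof.
have: H_elt i (psi (0 : CFM K (Xindex aleph (upset i)))).
  apply/H_eltP; exists 0 => //; split=> _; first by exists 0; rewrite scale0r.
  rewrite (_ : FR _ _ _ = finite_set (@set0 (Xindex aleph (upset i))))//.
  by congr finite_set; rewrite -subset0 => x [y] /=; rewrite eqxx.
by rewrite psi0.
Qed.

Lemma H_eltD i x y : H_elt i x -> H_elt i y -> H_elt i (x + y).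
Proof.
move=> xi yi; rewrite -[y]opprK -[- y]sub0r.
by apply: H_eltB => //; apply: H_eltB => //; exact: H_elt0.
Qed.

Lemma H_eltMn i x n : H_elt i x -> H_elt i (x *+ n).
Proof.
by move=> xi; elim: n => [|n IHn]; [exact: H_elt0|rewrite mulrS; exact: H_eltD].
Qed.

(** If [i] is maximal then [j = i] and scalars multiply; otherwise [psi_mul_le] moves the product
    into [upset i], where [FR] is a two-sided ideal. *)
Lemma H_eltM i j x y : (i <= j)%O -> H_elt i x -> H_elt j y ->
  H_elt i (x * y) /\ H_elt i (y * x).
Proof.
move=> ij /H_eltP[a [am aN] ->] /H_eltP[b [bm _] ->].
have [im|iN] := pselect (is_maximal i).
  move: b bm; rewrite (im _ ij) => b /(_ im)[l ->]; have [k ->] := am im.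
  rewrite -!psi_mul cfm_mul_scale1 cfm_scale1_mul !scalerA mulrC.
  have kl : H_elt i (psi ((k * l) *: (1 : CFM K (Xindex aleph (upset i))))).
    by apply/H_eltP; exists ((k * l) *: (1 : CFM K (Xindex aleph (upset i))));
      [split=> //; exists (k * l)|].
  by split.
have [c /(_ a)[-> ->]] := psi_mul_le b ij.
by split; apply/H_eltP; [exists (a * c)|exists (c * a)] => //; split=> // _;
  [apply: FR_mulr|apply: FR_mull]; exact: aN.
Qed.

Lemma H_eltZ i k x : H_elt i x -> H_elt i (k *: x).
Proof.
move=> /H_eltP[a [am aN] ->]; rewrite -psiZ; apply/H_eltP.
exists (k *: a) => //; split=> [im|iN]; last first.
  by rewrite -cfm_scale1_mul; apply: FR_mull; exact: aN.
by have [l ->] := am im; exists (k * l); rewrite scalerA.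
Qed.

Lemma H_elt_mul_incomparable i j x y :
  ~~ (i <= j)%O -> ~~ (j <= i)%O -> H_elt i x -> H_elt j y -> x * y = 0.
Proof.
by move=> ij ji /H_eltP[a _ ->] /H_eltP[b _ ->]; exact: psi_mul_incomparable.
Qed.

Lemma H_alg_ind J (P : CFM K (Xindex aleph I) -> Prop) :
  P 0 -> (forall x y, P x -> P y -> P (x + y)) ->
  (forall j x, J j -> H_elt j x -> P x) -> forall x, H_alg aleph K J x -> P x.
Proof.
move=> P0 PD PJ x [s [h [sJ ->]]]; rewrite big_seq.
by apply: big_ind => // j /sJ[Jj]; exact: PJ.
Qed.

Lemma H_alg0 J : H_alg aleph K J 0.
Proof. by exists [::], (fun=> 0); rewrite big_nil; split. Qed.

Lemma H_alg_elt J j x : J j -> H_elt j x -> H_alg aleph K J x.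
Proof.
move=> Jj xj; exists [:: j], (fun=> x); rewrite big_seq1; split=> // k.
by rewrite inE => /eqP ->.
Qed.

(** The two sums use different families and may repeat indices, so both are rewritten over one
    duplicate-free list, each index weighted by its multiplicity. *)
Lemma H_algD J x y : H_alg aleph K J x -> H_alg aleph K J y -> H_alg aleph K J (x + y).
Proof.
move=> [s [h [sJ ->]]] [t [g [tJ ->]]].
pose f r (h : I -> CFM K (Xindex aleph I)) j := h j *+ count_mem j r.
have sumE r (k : I -> CFM K (Xindex aleph I)) : {subset r <= s ++ t} ->
    \sum_(j <- r) k j = \sum_(j <- undup (s ++ t)) f r k j.
  move=> rst; rewrite -big_undup_iterop_count.
  rewrite [RHS](bigID (mem r)) /= [X in _ + X]big1 ?addr0; last first.
    by move=> j jr; rewrite /f (count_memPn jr).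
  rewrite -[RHS]big_filter; apply: perm_big; apply: uniq_perm.
  - exact: undup_uniq.
  - by rewrite filter_uniq// undup_uniq.
  - move=> j; rewrite mem_filter !mem_undup /=.
    by case: (boolP (j \in r)) => // /rst ->.
exists (undup (s ++ t)), (fun j => f s h j + f t g j); split; last first.
  rewrite big_split /= -!sumE// => j jr; rewrite mem_cat jr ?orbT//.
have fP r k j : (forall i, i \in r -> J i /\ H_elt i (k i)) -> H_elt j (f r k j).
  rewrite /f => rJ; have [/rJ[_ kj]|jr] := boolP (j \in r); first exact: H_eltMn.
  by rewrite (count_memPn jr); exact: H_elt0.
move=> j; rewrite mem_undup mem_cat => jst; split; last by apply: H_eltD; exact: fP.
by case/orP: jst => [/sJ|/tJ] [].
Qed.

Lemma H_algZ J k x : H_alg aleph K J x -> H_alg aleph K J (k *: x).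
Proof.
move: x; apply: H_alg_ind.
- by rewrite scaler0; exact: H_alg0.
- by move=> x y; rewrite scalerDr; exact: H_algD.
- by move=> j x Jj xj; apply: H_alg_elt Jj _; exact: H_eltZ.
Qed.

Lemma H_algB J x y : H_alg aleph K J x -> H_alg aleph K J y -> H_alg aleph K J (x - y).
Proof. by move=> xJ yJ; apply: H_algD => //; rewrite -scaleN1r; exact: H_algZ. Qed.

Lemma H_algM J x y : H_alg aleph K J x -> H_alg aleph K J y -> H_alg aleph K J (x * y).
Proof.
move=> xJ yJ; move: x xJ; apply: H_alg_ind.
- by rewrite mul0r; exact: H_alg0.
- by move=> x x'; rewrite mulrDl; exact: H_algD.
move=> i x Ji xi; move: y yJ; apply: H_alg_ind.
- by rewrite mulr0; exact: H_alg0.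
- by move=> y y'; rewrite mulrDr; exact: H_algD.
move=> j y Jj yj.
have [ij|ij] := boolP (i <= j)%O; first by apply: H_alg_elt Ji _; exact: (H_eltM ij xi yj).1.
have [ji|ji] := boolP (j <= i)%O; first by apply: H_alg_elt Jj _; exact: (H_eltM ji yj xi).2.
by rewrite (H_elt_mul_incomparable ij ji xi yj); exact: H_alg0.
Qed.

Lemma H_alg_sub J J' x : J `<=` J' -> H_alg aleph K J x -> H_alg aleph K J' x.
Proof.
move=> JJ' [s [h [sJ ->]]]; exists s, h; split=> // j /sJ[Jj hj].
by split=> //; exact: JJ'.
Qed.

Lemma H_alg_split J i x : H_alg aleph K J x ->
  exists y h, [/\ x = y + h, H_alg aleph K (J `\ i) y & H_elt i h].
Proof.
move: x; apply: H_alg_ind.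
- by exists 0, 0; rewrite addr0; split=> //; [exact: H_alg0|exact: H_elt0].
- move=> _ _ [y [h [-> yJ hi]]] [y' [h' [-> yJ' hi']]].
  by exists (y + y'), (h + h'); rewrite addrACA; split=> //; [exact: H_algD|exact: H_eltD].
- move=> j x Jj xj; have [ji|ji] := eqVneq j i.
    by exists 0, x; rewrite add0r -ji; split=> //; exact: H_alg0.
  exists x, 0; rewrite addr0; split=> //; last exact: H_elt0.
  by apply: H_alg_elt xj; split=> //; exact/eqP.
Qed.

(** Supplies the ambient identity that arguments with units require and that H(I,J) may lack. *)
Definition unitization J : set (CFM K (Xindex aleph I)) :=
  [set x | exists k h, H_alg aleph K J h /\ x = k *: (1 : CFM K (Xindex aleph I)) + h].

Lemma unital_subring_unitization J : unital_subring (unitization J).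
Proof.
split.
- by exists 1, 0; rewrite scale1r addr0; split=> //; exact: H_alg0.
- move=> _ _ [k [h [hJ ->]]] [k' [h' [hJ' ->]]].
  exists (k - k'), (h - h'); split; first exact: H_algB.
  by rewrite scalerBl opprD addrACA.
- move=> _ _ [k [h [hJ ->]]] [k' [h' [hJ' ->]]].
  exists (k * k'), (k *: h' + (k' *: h + h * h')); split.
    apply: H_algD; first exact: H_algZ.
    by apply: H_algD; [exact: H_algZ|exact: H_algM].
  by rewrite mulrDl mulrDr !cfm_scale1_mul scalerA mulrDr cfm_mul_scale1 -addrA.
Qed.

Lemma H_alg_unitization J h : H_alg aleph K J h -> unitization J h.
Proof. by move=> hJ; exists 0, h; rewrite scale0r add0r. Qed.

Lemma unitization_sub J J' x : J `<=` J' -> unitization J x -> unitization J' x.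
Proof. by move=> JJ' [k [h [/(H_alg_sub JJ') hJ ->]]]; exists k, h. Qed.

Lemma H_alg_unitizationM J x h :
  H_alg aleph K J h -> unitization J x -> H_alg aleph K J (h * x).
Proof.
move=> hJ [k [g [gJ ->]]]; rewrite mulrDr cfm_mul_scale1.
by apply: H_algD; [exact: H_algZ|exact: H_algM].
Qed.

(** By minimality of [i], each [j] in [J] is above [i], where [H_eltM] applies, or incomparable to
    it, where the products vanish. *)
Lemma unitization_H_elt_ideal J i x h : J i ->
  (forall j, J j -> (j <= i)%O -> j = i) -> H_elt i h -> unitization J x ->
  H_elt i (x * h) /\ H_elt i (h * x).
Proof.
move=> Ji imin hi [k [g [gJ ->]]].
rewrite mulrDl mulrDr cfm_scale1_mul cfm_mul_scale1.
suff [gh hg] : H_elt i (g * h) /\ H_elt i (h * g).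
  by split; apply: H_eltD => //; exact: H_eltZ.
move: g gJ; apply: H_alg_ind.
- by rewrite mul0r mulr0; split; exact: H_elt0.
- by move=> x' y [xh hx] [yh hy]; rewrite mulrDl mulrDr; split; exact: H_eltD.
move=> j y Jj yj.
have [ij|ij] := boolP (i <= j)%O; first by have [] := H_eltM ij hi yj.
have ji : ~~ (j <= i)%O.
  by apply: contra ij => ji; rewrite (imin _ Jj ji).
rewrite (H_elt_mul_incomparable ij ji hi yj) (H_elt_mul_incomparable ji ij yj hi).
by split; exact: H_elt0.
Qed.

(** * Adding an element of H(I,i) inside a subring where H(I,i) is an ideal *)

Section AddElement.
Context (S : set (CFM K (Xindex aleph I))) (Ssub : unital_subring S) (i : I).
Context (H_eltS : forall h, H_elt i h -> S h).
Context (H_elt_ideal : forall x h, S x -> H_elt i h -> H_elt i (x * h) /\ H_elt i (h * x)).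

(** Since H(I,i) consists of the scalar multiples of [e] and is an ideal, [ve] and [ev] are scalar
    multiples of [e], inverted by inverting the scalar. *)
Lemma primitive_psi1 : is_maximal i ->
  primitive S (psi (1 : CFM K (Xindex aleph (upset i)))).
Proof.
move=> im; set e := psi _.
have ei k : H_elt i (k *: e).
  by rewrite -psiZ; apply/H_eltP;
    exists (k *: (1 : CFM K (Xindex aleph (upset i)))) => //; split=> // _; exists k.
have eP h : H_elt i h -> exists k, h = k *: e.
  by move=> /H_eltP[a [/(_ im)[k ->] _] ->]; exists k; rewrite psiZ.
have e1 : H_elt i e by rewrite -[e]scale1r.
have ee : e * e = e by rewrite -psi_mul mulr1.
have inv v : H_elt i v -> v != 0 ->
    exists2 w, S w & [/\ e * w = w, w * e = w, w * v = e & v * w = e].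
  move=> /eP[k ->] ke0.
  have k0 : k != 0 by apply: contra_neq ke0 => ->; rewrite scale0r.
  exists (k^-1 *: e); first exact/H_eltS.
  by rewrite -!cfm_scalerAl -!cfm_scalerAr !scalerA ee divff ?mulVf// scale1r.
split=> //; first exact: H_eltS.
  move=> v Sv <- ve0; have [|w Sw [ew _ wv _]] := inv (v * e) _ ve0.
    exact: (H_elt_ideal Sv e1).1.
  by exists w.
move=> v Sv <- ve0; have [|w Sw [_ we _ vw]] := inv (e * v) _ ve0.
  exact: (H_elt_ideal Sv e1).2.
by exists w.
Qed.

(** By the ideal property, [ve] is the image of a matrix living in column [r]. A matrix unit scaled
    by the inverse of a nonzero entry moves that entry to position [(r, r)]; rows are treated
    dually. *)
Lemma primitive_psi_mxunit (r : Xindex aleph (upset i)) : ~ is_maximal i ->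
  primitive S (psi (mxunit r r : CFM K _)).
Proof.
move=> iN; set E := mxunit r r; set e := psi _.
have unitH u v k : H_elt i (k *: psi (mxunit u v : CFM K (Xindex aleph (upset i)))).
  by apply: H_eltZ; apply/H_eltP; exists (mxunit u v) => //; split=> // _; exact: mxunit_FR.
have e1 : H_elt i e by rewrite -[e]scale1r; exact: unitH.
have nz_entry (a : CFM K (Xindex aleph (upset i))) : psi a != 0 -> exists u v, a u v != 0.
  apply: contra_neqP => aN; rewrite (_ : a = 0) ?psi0//; apply: cfm_ext => u v.
  by apply/eqP; apply: contra_notT aN => auv; exists u, v.
have EE u v w : mxunit u v * mxunit v w = mxunit u w :> CFM K (Xindex aleph (upset i)).
  by apply: cfm_ext => x y; rewrite mul_mxunitE /= eqxx andTb -natrM mulnb.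
split.
- exact: H_eltS.
- by rewrite -psi_mul EE.
- move=> v Sv <- ve0; have /H_eltP[a [_ /(_ iN) aFR] veE] := (H_elt_ideal Sv e1).1.
  move: ve0; rewrite (_ : v * e = psi (a * E)); last first.
    by rewrite psi_mul -veE -mulrA -psi_mul EE.
  move=> /nz_entry[u [w]]; rewrite mul_mxunitrE mulf_eq0 negb_or => /andP[aur _].
  exists ((a u r)^-1 *: psi (mxunit r u : CFM K _)); first exact: H_eltS.
  rewrite -cfm_scalerAr -cfm_scalerAl -!psi_mul EE; split=> //.
  rewrite -psiZ; congr psi; apply: cfm_ext => x y.
  by rewrite cfm_scaleE mul_mxunitE mul_mxunitrE (mulrCA _ (a u r)) mulKf// -natrM mulnb.
- move=> v Sv <- ve0; have /H_eltP[a [_ /(_ iN) aFR] veE] := (H_elt_ideal Sv e1).2.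
  move: ve0; rewrite (_ : e * v = psi (E * a)); last first.
    by rewrite psi_mul -veE mulrA -psi_mul EE.
  move=> /nz_entry[w [u]]; rewrite mul_mxunitE mulf_eq0 negb_or => /andP[_ aru].
  exists ((a r u)^-1 *: psi (mxunit u r : CFM K _)); first exact: H_eltS.
  rewrite -cfm_scalerAr -cfm_scalerAl -!psi_mul EE; split=> //.
  rewrite -psiZ; congr psi; apply: cfm_ext => x y.
  rewrite cfm_scaleE mul_mxunitrE mul_mxunitE -mulrA (mulrCA _ (a r u)).
  by rewrite mulKf// -natrM mulnb.
Qed.

Lemma unit_regular_inD_H_elt x h :
  S x -> unit_regular_in S x -> H_elt i h -> unit_regular_in S (x + h).
Proof.
move=> Sx xreg hi; have [im|iN] := pselect (is_maximal i).
  have Sh := H_eltS hi; move: hi => /H_eltP[a [/(_ im)[k ->] _] hE].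
  (* [h] is a multiple of [psi 1], hence of the form [e * h] with [e = psi 1]. *)
  rewrite hE -[k *: _]mul1r psi_mul -hE.
  exact: (unit_regular_inD_primitive Ssub (primitive_psi1 im) Sx Sh xreg).
move: hi => /H_eltP[a [_ /(_ iN) aFR] ->{h}].
have [s sE] := (finite_seqP _).1 aFR.
have {sE} : forall u, u \notin s -> forall v, a u v = 0.
  move=> u us v; apply/eqP; apply: contraNT us => auv.
  by have : [set` s] u by rewrite -sE; exists v.
(* The nonzero rows of [a] are split off one at a time: row [r] is [mxunit r r * a], whose image has
   the form [e * w]. *)
elim: s a aFR x Sx xreg => [|r s IHs] a aFR x Sx xreg a0.
  rewrite (_ : a = 0) ?psi0 ?addr0//.
  by apply: cfm_ext => u v; exact: a0.
have -> : psi a = psi (mxunit r r) * psi a + psi (a - mxunit r r * a).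
  by rewrite -psi_mul psiB addrC subrK.
have Spsi (c : CFM K (Xindex aleph (upset i))) : FR K _ c -> S (psi c).
  by move=> cFR; apply: H_eltS; apply/H_eltP; exists c => //; split.
have rFR : FR K _ (mxunit r r * a) by exact/FR_mulr/mxunit_FR.
have [_ SB SM] := Ssub.
have Sr : S (psi (mxunit r r) * psi a).
  by rewrite -psi_mul; exact: Spsi.
rewrite addrA; apply: IHs.
- exact: FR_sub.
- rewrite -[_ * psi a]opprK; apply: (SB) => //.
  by rewrite -sub0r; apply: (SB) => //; rewrite -(subrr x); exact: SB.
- by apply: (unit_regular_inD_primitive Ssub (primitive_psi_mxunit r iN) Sx _ xreg); exact: Spsi.
move=> u us v; have -> : (a - mxunit r r * a) u v = a u v - (mxunit r r * a) u v by [].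
rewrite mul_mxunitE; have [->|ur] := eqVneq u r; first by rewrite mul1r subrr.
by rewrite mul0r subr0 a0// inE (negbTE ur).
Qed.

End AddElement.

Lemma unit_regular_in_unitization (s : seq I) x :
  unitization [set` s] x -> unit_regular_in (unitization [set` s]) x.
Proof.
(* Induction on a bound for the length of [s], because removing [i] deletes all of its
   occurrences. *)
elim: {s}(size s) {-2}s (leqnn (size s)) x => [|n IHn] s.
  (* Without indices the unitization consists of scalar matrices, each of them zero or
     invertible. *)
  rewrite leqn0 size_eq0 => /eqP -> x [k [h [[t [g [tN ->]]] ->]]].
  have -> : \sum_(j <- t) g j = 0 by rewrite big_seq big1// => j /tN[].
  rewrite addr0; have [->|k0] := eqVneq k 0.
    rewrite scale0r; apply: unit_regular_in_idempotent; last exact: mulr0.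
    exact: unital_subring_unitization.
  have kS l : unitization [set` [::]] (l *: (1 : CFM K (Xindex aleph I))).
    by exists l, 0; rewrite addr0; split=> //; exact: H_alg0.
  exists (k^-1 *: (1 : CFM K (Xindex aleph I))).
    split=> //; exists (k *: (1 : CFM K (Xindex aleph I))) => //.
    by split; rewrite cfm_scale1_mul scalerA ?mulfV ?mulVf ?scale1r.
  by rewrite cfm_scale1_mul cfm_mul_scale1 !scalerA -?mulrA mulfV// mulr1.
move=> ssz x xS; have [s0|/seq_minimal[i is_ imin]] := eqVneq s [::].
  by apply: IHn xS; rewrite s0.
have Ssub := @unital_subring_unitization [set` s].
pose s' := filter (predC1 i) s.
have s's : [set` s'] `<=` [set` s] by move=> j /=; rewrite mem_filter => /andP[].
have [k [h [hJ ->]]] := xS.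
have [y [g [-> yJ gi]]] := H_alg_split i hJ.
have yS' : unitization [set` s'] (k *: (1 : CFM K (Xindex aleph I)) + y).
  exists k, y; split=> //; apply: H_alg_sub yJ => j /= [js ji].
  by rewrite mem_filter js andbT; apply/eqP.
rewrite addrA; apply: (unit_regular_inD_H_elt Ssub) gi.
- by move=> z zi; apply/H_alg_unitization/(H_alg_elt (j := i)).
- by move=> z w zS wi; apply: unitization_H_elt_ideal wi zS.
- exact: unitization_sub s's yS'.
(* A unit for [s'] remains one for [s], because both unitizations have the same identity 1. *)
have [|u [uS [v vS uv]] yE] := IHn s' _ _ yS'.
  rewrite -ltnS (leq_trans _ ssz)// size_filter -(count_predC (predC1 i) s).
  rewrite -[X in (X < _)%N]addn0 ltn_add2l -has_count; apply/hasP; exists i => //=.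
  by rewrite eqxx.
by exists u => //; split; [|exists v => //]; exact: unitization_sub s's _.
Qed.

Lemma locally_unit_regular_H_alg J : locally_unit_regular (H_alg aleph K J).
Proof.
move=> e eJ ee.
have cornerP x : corner (H_alg aleph K J) e x <-> [/\ H_alg aleph K J x, e * x = x & x * e = x].
  split=> [[y yJ <-]|[xJ ex xe]]; last by exists x; rewrite ?ex ?xe.
  split; first by do 2?apply: H_algM.
    by rewrite !mulrA ee.
  by rewrite -(mulrA _ e e) ee.
exists e; first by split; [exact/cornerP|move=> x /cornerP[]].
move=> x /cornerP[xJ ex xe].
(* [s] collects the indices occurring in [e] and in [x]. *)
have [s [sJ es xs]] : exists s : seq I, [/\ [set` s] `<=` J,
    H_alg aleph K [set` s] e & H_alg aleph K [set` s] x].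
  case: eJ => s [h [sJ eE]]; case: xJ => t [g [tJ xE]]; exists (s ++ t); split.
  - by move=> j /=; rewrite mem_cat => /orP[/sJ|/tJ] [].
  - by exists s, h; split=> // j js; split; [rewrite /= mem_cat js|exact: (sJ _ js).2].
  - by exists t, g; split=> // j jt; split; [rewrite /= mem_cat jt orbT|exact: (tJ _ jt).2].
have Ssub := @unital_subring_unitization [set` s].
have eS := H_alg_unitization es; have xS := H_alg_unitization xs.
(* Elements produced in the unitization return to H(I,J): [y = ey], and H(I,s) absorbs
   multiplication by the unitization. *)
have cornerS y : unitization [set` s] y -> e * y = y -> y * e = y ->
    corner (H_alg aleph K J) e y.
  move=> yS ey ye; apply/cornerP; split=> //; rewrite -ey.
  by apply: (H_alg_sub sJ); exact: H_alg_unitizationM.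
have [|y yS [ey ye xE [z zS [ez ze yz zy]]]] := unit_regular_in_corner Ssub eS ee xS ex xe.
  apply: unit_regular_in_unitization.
  have [S1 SB SM] := Ssub; rewrite -opprB.
  by apply: (SB) => //; exact: SB.
exists y; last by [].
by split; [exact: cornerS|exists z => //; exact: cornerS].
Qed.

End Span.

(** * Identity of H(I,J) *)

Section Cofinal.
Context {d : Order.disp_t} {P : porderType d}.
Context (P_cofinal : finite_cofinal P).

(** If each [f] of the finite cofinal set failed to bound the chain, the largest of the finitely
    many witnesses would lie below no [f] at all. *)
Lemma maximal_chain_bounded (A : set P) j : total_on A <=%O -> A j ->
  exists f, forall k, A k -> (k <= f)%O.
Proof.
move=> Achain Aj; have [F /finite_seqP[r ->] Fcof] := P_cofinal.
apply: contrapT => nobound.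
have {nobound} unbounded f : exists k, A k /\ ~ (k <= f)%O.
  apply: contrapT => Af; apply: nobound; exists f => k Ak.
  by apply: contrapT => kf; apply: Af; exists k.
suff [k [Ak kr]] : exists k, A k /\ forall f, f \in r -> ~ (k <= f)%O.
  by have [f fr kf] := Fcof k; exact: kr fr kf.
elim: r {Fcof} => [|f r [k [Ak kr]]]; first by exists j.
have [l [Al lf]] := unbounded f.
have [kl|lk] := Achain _ _ Ak Al.
  exists l; split=> // g; rewrite inE => /predU1P[->//|gr lg].
  exact: kr gr (le_trans kl lg).
exists k; split=> // g; rewrite inE => /predU1P[->|gr]; last exact: kr.
by move=> kf; apply: lf; exact: le_trans lk kf.
Qed.

(** Any [k] above a bound [f] of [A] is comparable with all of [A], hence in [A] and so below [f];
    thus [f] is in [A] and is maximal. *)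
Lemma maximal_chain_maximal (A : set P) j : maximal_chains P A -> A j ->
  exists m, [/\ A m, is_maximal m & (j <= m)%O].
Proof.
move=> [Achain Amax] Aj; have [f Af] := maximal_chain_bounded Achain Aj.
have topA k : (f <= k)%O -> A k.
  move=> fk; rewrite -(Amax (A `|` [set k])); first by right.
    have Ak l : A l -> (l <= k)%O by move=> /Af lf; exact: le_trans lf fk.
    by move=> l m [Al|->] [Am|->]; [exact: Achain|left; exact: Ak|right; exact: Ak|left].
  by move=> l; left.
exists f; split; [exact: topA| |exact: Af].
by move=> k fk; apply/eqP; rewrite eq_le fk andbT; exact/Af/topA.
Qed.

(** Maximal elements belong to every cofinal set, so they are finite in number; conversely, a
    maximal element of a cofinal set is maximal in [P]. *)
Lemma finitely_sheltered_setT : finitely_sheltered [set: P].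
Proof.
have [F Ffin Fcof] := P_cofinal.
split=> //; first by apply: sub_finite_set Ffin => m [mmax _]; have [f Ff /mmax <-] := Fcof m.
move=> j _; have [r rE] := (finite_seqP _).1 Ffin.
have [f Ff jf] := Fcof j.
have fr : f \in [seq g <- r | (f <= g)%O].
  by rewrite mem_filter lexx; move: Ff; rewrite rE.
(* The dual order yields a maximal element among the members of the cofinal set above [f]. *)
have [|m] := @seq_minimal _ (P^d)%type [seq g <- r | (f <= g)%O].
  by apply: contraTneq fr => ->.
rewrite mem_filter => /andP[fm _] mmin.
have jm := le_trans jf fm.
exists m => //; split; last by exists j.
move=> k mk; have [g Fg kg] := Fcof k.
have gm : g = m.
  apply: mmin; last exact: le_trans mk kg.
  rewrite mem_filter (le_trans fm (le_trans mk kg)).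
  by move: Fg; rewrite rE.
by apply/eqP; rewrite eq_le mk -{1}gm kg.
Qed.

End Cofinal.

(** * Finitely sheltered subsets *)

Section Sheltered.
Context {d : Order.disp_t} {aleph : bOrderType d} {K : fieldType}.
Context {d' : Order.disp_t} {I : porderType d'}.
Context (I_cofinal : finite_cofinal I).

Lemma cfm_sumE (T : eqType) (s : seq T) (F : T -> CFM K (Xindex aleph I)) x y :
  (\sum_(i <- s) F i) x y = \sum_(i <- s) F i x y.
Proof. exact: (big_morph (fun a : CFM K (Xindex aleph I) => a x y)). Qed.

Lemma mul_psi1E i (a : CFM K (Xindex aleph I)) x y :
  (psi (1 : CFM K (Xindex aleph (upset i))) * a) x y = `[< val x.2 i >]%:R * a x y.
Proof.
rewrite cfm_mulE (fsbig_support1 (z0 := x)) => [|z zx].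
  by rewrite psi1E eqxx andbT.
by rewrite psi1E eq_sym (negbTE zx) andbF mul0r.
Qed.

Lemma mul_psi1rE i (a : CFM K (Xindex aleph I)) x y :
  (a * psi (1 : CFM K (Xindex aleph (upset i)))) x y = a x y * `[< val y.2 i >]%:R.
Proof.
rewrite cfm_mulE (fsbig_support1 (z0 := y)) => [|z zy].
  by rewrite psi1E eqxx andbT.
by rewrite psi1E (negbTE zy) andbF mulr0.
Qed.

Lemma is_identity_sheltered (J : set I) : finitely_sheltered J ->
  exists u, is_identity (H_alg aleph K J) u.
Proof.
move=> [/finite_seqP[s0 s0E] Jle starJ].
pose s := undup s0.
have sE m : (m \in s) = `[< star J m >].
  by rewrite mem_undup; apply/idP/asboolP; rewrite s0E.
(* The chain of [x] contains a maximal element [m] above [j], which lies in [star J]; two maximal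
   elements of one chain coincide, so a single term is 1. *)
have sum1 (x : Xindex aleph I) j : J j -> val x.2 j ->
    \sum_(m <- s) `[< val x.2 m >]%:R = 1 :> K.
  move=> Jj xj; have [m [xm mmax jm]] := maximal_chain_maximal I_cofinal (set_mem (valP x.2)) xj.
  have ms : m \in s by rewrite sE; apply/asboolP; split=> //; exists j.
  rewrite (bigD1_seq m) ?undup_uniq//= asboolT// big1_seq ?addr0// => k /andP[km].
  rewrite sE => /asboolP[kmax _]; rewrite asboolF// => xk.
  case/negP: km; apply/eqP; have [/(_ _ _ xk xm)[/kmax ->//|/mmax ->//] _] := set_mem (valP x.2).
pose u : CFM K (Xindex aleph I) := \sum_(m <- s) psi (1 : CFM K (Xindex aleph (upset m))).
exists u; split.
  exists s, (fun m => psi (1 : CFM K (Xindex aleph (upset m)))); split=> // m.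
  rewrite sE => /asboolP mJ; split; first exact: starJ.
  apply/H_eltP; exists 1 => //; split=> [_|]; first by exists 1; rewrite scale1r.
  by have [mmax _] := mJ.
apply: H_alg_ind => [|x y [ux xu] [uy yu]|j h Jj /H_eltP[a _ ->]].
- by rewrite mulr0 mul0r.
- by rewrite mulrDr mulrDl ux uy xu yu.
(* A nonzero entry of [psi a] has [j] in the chains of its row and column, so [sum1] applies to the
   row for [u * x] and to the column for [x * u]. *)
rewrite mulr_suml mulr_sumr; split; apply: cfm_ext => x y; rewrite cfm_sumE.
  under eq_bigr do rewrite mul_psi1E.
  have [->|/psi_neq0[xj _ _]] := eqVneq (psi a x y) 0; first by rewrite big1// => m _; rewrite mulr0.
  by rewrite -mulr_suml (sum1 _ _ Jj xj) mul1r.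
under eq_bigr do rewrite mul_psi1rE.
have [->|/psi_neq0[_ yj _]] := eqVneq (psi a x y) 0; first by rewrite big1// => m _; rewrite mul0r.
by rewrite -mulr_sumr (sum1 _ _ Jj yj) mulr1.
Qed.

(** The corner at the identity element is the whole algebra. *)
Lemma unit_regular_H_alg_sheltered (J : set I) :
  finitely_sheltered J -> unit_regular (H_alg aleph K J).
Proof.
move=> /is_identity_sheltered[u [uJ uid]].
have uu : u * u = u by have [] := uid _ uJ.
have cornerE : corner (H_alg aleph K J) u = H_alg aleph K J.
  apply/seteqP; split=> [_ [x xJ <-]|x xJ]; have [ux xu] := uid _ xJ.
    by rewrite ux xu.
  by exists x; rewrite ?ux.
by rewrite -cornerE; exact: locally_unit_regular_H_alg.
Qed.

End Sheltered.

Theorem corollary4p4 (d d' : Order.disp_t) (aleph : bOrderType d)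
    (K : fieldType) (I : porderType d')
    (aleph_card : infinite_initial_ordinal aleph)
    (I_aleph : aleph_poset aleph I) (I_cofinal : finite_cofinal I) :
  (forall J : set I, locally_unit_regular (H_alg aleph K J)) /\
  (forall J : set I, finitely_sheltered J -> unit_regular (H_alg aleph K J)) /\
  unit_regular (B_alg aleph K I).
Proof.
split; first exact: locally_unit_regular_H_alg.
split=> [J|]; first exact: unit_regular_H_alg_sheltered.
exact/unit_regular_H_alg_sheltered/finitely_sheltered_setT.
Qed.
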